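(* Let $(M,g_{ab},\phi)$ be a spacetime with a smooth real scalar field $\phi$ which solves the gravitational field equation $E_{ab}=8\pi T_{ab}$ with (nonsingular) energy-momentum tensor $$T_{ab} = p_{,X}\,\nabla_a\phi\,\nabla_b\phi + p\,g_{ab},\qquad p=p(\phi,X),\quad X=-\tfrac12\nabla_a\phi\,\nabla^a\phi,$$ and which admits a Killing vector field $\xi^a$. Put $$Y \equiv p_{,\phi}\,(\pounds_\xi\phi)^2 + 2Xp_{,X}\,\pounds_\xi(\pounds_\xi\phi).$$ Then at each point of the spacetime: (a) $p_{,\phi}\ne0$ and $Xp_{,X}=0$ imply $\pounds_\xi\phi=0$; (b) $p_{,\phi}\neq0$ and $Xp_{,X}\ne0$ imply $Y\,\pounds_\xi\phi=0$; (c) $p_{,\phi}=0$ and $Xp_{,X}=0$, with admissible $T_{ab}$, imply $(\pounds_\xi\pounds_\xi\phi)(\pounds_\xi\phi)=0$, except possibly at points which are exceptional; (d) $p_{,\phi}=0$ and $Xp_{,X}\neq0$ imply $(\pounds_\xi\pounds_\xi\phi)(\pounds_\xi\phi)=0$. Furthermore, let $\gamma$ be a nonsingular orbit of $\xi^a$ which does not contain exceptional points, and let $\pounds_\xi\phi$ be a $C^1$ function. Then: (i) if $Xp_{,X}=0$ on $\gamma$ and $T_{ab}$ is admissible, then $\pounds_\xi\pounds_\xi\phi=0$ holds along $\gamma$; (ii) if $Xp_{,X}\ne0$ on $\gamma$, then the function $\pounds_\xi\phi$ is a solution to $Y=0$ along $\gamma$ which is either identically zero along $\gamma$ or does not have any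 zeros on $\gamma$.
   Context: $M$ is a smooth Hausdorff paracompact connected manifold of dimension $D\ge 2$, $g_{ab}$ is a smooth Lorentzian metric of signature $(-,+,\dots,+)$ with Levi-Civita connection $\nabla_a$. $E_{ab}$ is a tensor built from the metric as a polynomial in the Riemann tensor, possibly containing covariant derivatives of it and the Levi-Civita (volume) tensor (e.g. the Einstein tensor plus $\Lambda g_{ab}$, or a Lovelock tensor). $p$ is a given sufficiently smooth real function of two real variables $(\phi,X)$, with $p_{,X}\equiv\partial p/\partial X$ and $p_{,\phi}\equiv\partial p/\partial\phi$; $p$, $p_{,X}$, $p_{,\phi}$ are regarded as functions on $M$ by evaluating them on the field $\phi$ and on $X=-\frac12\nabla_a\phi\nabla^a\phi$. ''Nonsingular'' means that all these quantities are regular (finite and continuous) where considered. $\xi^a$ Killing means $\pounds_\xi g_{ab}=0$, where $\pounds_\xi$ is the Lie derivative. The energy-momentum tensor is called admissible if the function $p=p(\phi,X)$ is such that, for any vector field $v^a$, $\pounds_v(p_{,X})$ vanishes whenever (i.e. at every point where) both $X=0$ and $\pounds_v X=0$. A point $s\in M$ is called exceptional (with respect to $\xi^a$) if all three functions $p_{,\phi}$, $p_{,X}$ and $\pounds_\xi(p_{,X})$ vanish at $s$. *)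

(* Defs.v *)
From mathcomp Require Export all_boot all_order all_fingroup all_algebra.
From mathcomp Require Export all_classical all_reals all_analysis.
Export numFieldNormedType.Exports.
Export Order.TTheory GRing.Theory Num.Theory.

Set Implicit Arguments.
Unset Strict Implicit.
Unset Printing Implicit Defensive.

Local Open Scope classical_set_scope.
Local Open Scope ring_scope.

Section Euclidean.
Variables (R : realType) (n : nat).

Definition partial (i : 'I_n) (f : 'rV[R]_n -> R) : 'rV[R]_n -> R :=
  fun x => 'D_(delta_mx 0 i) f x.

(* f is of class C^k on the open set A. *)
Fixpoint Ck (k : nat) (A : set 'rV[R]_n) (f : 'rV[R]_n -> R) : Prop :=
  (forall x, A x -> {for x, continuous f}) /\
  (if k is k'.+1 then
     forall i : 'I_n,
       (forall x, A x -> derivable f x (delta_mx 0 i)) /\ Ck k' A (partial i f)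
   else True).

End Euclidean.

Definition paracompact (T : topologicalType) : Prop :=
  forall F : set (set T),
    (forall A, F A -> open A) -> \bigcup_(A in F) A = setT ->
  exists G : set (set T),
    [/\ forall B, G B -> open B,
        \bigcup_(B in G) B = setT,
        forall B, G B -> exists2 A, F A & B `<=` A
      & forall x : T, exists2 V : set T, nbhs x V &
          finite_set [set B | G B /\ B `&` V !=set0]].

(* [chart_fun] and [chart_inv] are only meaningful on [chart_dom] and on its
   image. *)
Record chart (R : realType) (D : nat) (T : topologicalType) := Chart {
  chart_dom : set T;
  chart_fun :> T -> 'rV[R]_D;
  chart_inv : 'rV[R]_D -> T;
  chart_dom_open : open chart_dom;
  chart_cod_open : open (chart_fun @` chart_dom);
  chart_funK : forall x, chart_dom x -> chart_inv (chart_fun x) = x;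
  chart_fun_cont : forall x, chart_dom x -> {for x, continuous chart_fun};
  chart_inv_cont :
    forall y, (chart_fun @` chart_dom) y -> {for y, continuous chart_inv}
}.

Section Charts.
Variables (R : realType) (D : nat) (T : topologicalType).
Implicit Types (c : chart R D T) (f : T -> R).

Definition coord c (i : 'I_D) : T -> R := fun x => c x 0 i.

(* The partial derivative d f / d x^i in the coordinates of c, as a function
   of the point. *)
Definition pd c (i : 'I_D) f : T -> R :=
  fun x => partial i (f \o chart_inv c) (c x).

Definition chart_Ck c (W : set T) (k : nat) f : Prop :=
  Ck k (c @` W) (f \o chart_inv c).

Definition chart_smooth c (W : set T) f : Prop := forall k, chart_Ck c W k f.

End Charts.

(* The atlas need not be maximal.  [chart_at] selects a chart around each
   point; the notions defined through it do not depend on the selection. *)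
Record manifold (R : realType) (D : nat) := Manifold {
  mspace :> topologicalType;
  atlas : set (chart R D mspace);
  chart_at : mspace -> chart R D mspace;
  chart_at_atlas : forall x, atlas (chart_at x);
  chart_at_dom : forall x, chart_dom (chart_at x) x;
  atlas_compat : forall c c', atlas c -> atlas c' -> forall i,
    chart_smooth c (chart_dom c `&` chart_dom c') (coord c' i);
  mspace_hausdorff : hausdorff_space mspace;
  mspace_paracompact : paracompact mspace;
  mspace_connected : connected [set: mspace]
}.

Section Tensors.
Variables (R : realType) (D : nat) (M : manifold R D).
Local Notation chartM := (chart R D M).

Definition class_C (k : nat) (f : M -> R) : Prop :=
  forall c, atlas c -> chart_Ck c (chart_dom c) k f.

Definition smooth (f : M -> R) : Prop := forall k, class_C k f.

(* Components, in every chart, of a covariant tensor field of rank n and of a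
   vector field.  Only the values for charts c of the atlas and points of the
   domain of c are meaningful. *)
Definition components (n : nat) := chartM -> n.-tuple 'I_D -> M -> R.
Definition vcomponents := chartM -> 'I_D -> M -> R.

Definition tensor_field n (t : components n) : Prop :=
  (forall c, atlas c -> forall I, chart_smooth c (chart_dom c) (t c I)) /\
  (forall c c', atlas c -> atlas c' ->
   forall x, chart_dom c x -> chart_dom c' x -> forall J : n.-tuple 'I_D,
     t c' J x = \sum_(I : n.-tuple 'I_D)
       t c I x * \prod_(k < n) pd c' (tnth J k) (coord c (tnth I k)) x).

Definition vector_field (v : vcomponents) : Prop :=
  (forall c, atlas c -> forall i, chart_smooth c (chart_dom c) (v c i)) /\
  (forall c c', atlas c -> atlas c' ->
   forall x, chart_dom c x -> chart_dom c' x -> forall i : 'I_D,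
     v c' i x = \sum_(j < D) pd c j (coord c' i) x * v c j x).

Definition lie (v : vcomponents) (f : M -> R) : M -> R :=
  fun x => let c := chart_at x in \sum_(i < D) v c i x * pd c i f x.

(* The entry of rank k (starting from 0) of a multi-index, and the multi-index
   with this entry replaced. *)
Definition idx n (I : n.+1.-tuple 'I_D) (k : nat) : 'I_D := tnth I (inord k).
Definition set_idx n (I : n.-tuple 'I_D) (k : 'I_n) (d : 'I_D) :
  n.-tuple 'I_D := [tuple if j == k then d else tnth I j | j < n].

Definition lie_tensor (v : vcomponents) n (t : components n) : components n :=
  fun c I x =>
    \sum_(d < D) v c d x * pd c d (t c I) x +
    \sum_(k < n) \sum_(d < D) t c (set_idx I k d) x * pd c (tnth I k) (v c d) x.

Definition add_tensor n (s t : components n) : components n :=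
  fun c I x => s c I x + t c I x.

Definition scale_tensor n (a : R) (t : components n) : components n :=
  fun c I x => a * t c I x.

Definition mul_tensor m n (s : components m) (t : components n) :
  components (m + n) :=
  fun c I x => s c [tuple tnth I (lshift n j) | j < m] x *
               t c [tuple tnth I (rshift m j) | j < n] x.

Definition perm_tensor n (s : 'S_n) (t : components n) : components n :=
  fun c I x => t c [tuple tnth I (s j) | j < n] x.

Section Metric.
Variable g : components 2.

Definition metric_mx (c : chartM) (x : M) : 'M[R]_D :=
  \matrix_(a, b) g c [tuple a; b] x.

Definition minkowski : 'M[R]_D :=
  diag_mx (\row_(i < D) if (i == 0%N :> nat) then -1 else 1).

Definition lorentzian : Prop :=
  [/\ tensor_field g,
      forall c, atlas c -> forall x, chart_dom c x ->
        (metric_mx c x)^T = metric_mx c x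
    & forall c, atlas c -> forall x, chart_dom c x ->
        exists2 P : 'M[R]_D,
          P \in unitmx & P *m metric_mx c x *m P^T = minkowski].

Definition killing (v : vcomponents) : Prop :=
  vector_field v /\
  forall c, atlas c -> forall x, chart_dom c x -> forall I,
    lie_tensor v g c I x = 0.

(* g^{ab} *)
Definition ginv (c : chartM) (a b : 'I_D) : M -> R :=
  fun x => invmx (metric_mx c x) a b.

(* Gamma^a_{bc}, the coefficients of the Levi-Civita connection. *)
Definition christoffel (c : chartM) (a b e : 'I_D) : M -> R := fun x =>
  2^-1 * \sum_(d < D) ginv c a d x *
    (pd c b (g c [tuple d; e]) x + pd c e (g c [tuple b; d]) x
     - pd c d (g c [tuple b; e]) x).

(* nabla_i t_{J}; the index of the derivative comes first. *)
Definition nabla n (t : components n) : components n.+1 := fun c I x =>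
  let i := thead I in
  let J : n.-tuple 'I_D := [tuple of behead I] in
  pd c i (t c J) x -
  \sum_(k < n) \sum_(d < D)
     christoffel c d i (tnth J k) x * t c (set_idx J k d) x.

(* R_{abef} = g_{ah} R^h_{bef}, where R^h_{bef} v^b = [nabla_e, nabla_f] v^h. *)
Definition riemann : components 4 := fun c I x =>
  let a := idx I 0%N in let b := idx I 1%N in
  let e := idx I 2%N in let f := idx I 3%N in
  let Gamma := christoffel c in
  \sum_(h < D) g c [tuple a; h] x *
    (pd c e (Gamma h f b) x - pd c f (Gamma h e b) x +
     \sum_(k < D) (Gamma h e k x * Gamma k f b x
                   - Gamma h f k x * Gamma k e b x)).

(* g^{ab} t_{abI} *)
Definition contract_tensor n (t : components n.+2) : components n :=
  fun c I x => \sum_(a < D) \sum_(b < D)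
    ginv c a b x * t c [tuple of a :: b :: I] x.

(* A Levi-Civita (volume) tensor.  It is global, hence exists on an orientable
   M only; tensors of even degree in it can be written with the metric. *)
Definition volume_tensor (eps : components D) : Prop :=
  [/\ tensor_field eps,
      forall c, atlas c -> forall x, chart_dom c x ->
        forall (s : 'S_D) (I : D.-tuple 'I_D),
        eps c [tuple tnth I (s j) | j < D] x = (-1) ^+ s * eps c I x
    & forall c, atlas c -> forall x, chart_dom c x ->
        eps c (ord_tuple D) x ^+ 2 = `|\det (metric_mx c x)|].

(* The tensors built from the metric as polynomials in the Riemann tensor, its
   covariant derivatives and the Levi-Civita tensor.  As g_{ab} is among the
   generators, all indices may be taken lowered and contractions with g^{ab}
   cover the raising of indices. *)
Inductive metric_polynomial : forall n, components n -> Prop :=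
| MP_metric : metric_polynomial g
| MP_riemann : metric_polynomial riemann
| MP_volume eps : volume_tensor eps -> metric_polynomial eps
| MP_add n (s t : components n) :
    metric_polynomial s -> metric_polynomial t ->
    metric_polynomial (add_tensor s t)
| MP_scale n (a : R) (t : components n) :
    metric_polynomial t -> metric_polynomial (scale_tensor a t)
| MP_mul m n (s : components m) (t : components n) :
    metric_polynomial s -> metric_polynomial t ->
    metric_polynomial (mul_tensor s t)
| MP_perm n (s : 'S_n) (t : components n) :
    metric_polynomial t -> metric_polynomial (perm_tensor s t)
| MP_contract n (t : components n.+2) :
    metric_polynomial t -> metric_polynomial (contract_tensor t)
| MP_nabla n (t : components n) :
    metric_polynomial t -> metric_polynomial (nabla t).

Variable phi : M -> R.

(* X = - 1/2 nabla_a phi nabla^a phi *)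
Definition kinetic : M -> R := fun x =>
  let c := chart_at x in
  - 2^-1 * \sum_(a < D) \sum_(b < D)
    ginv c a b x * pd c a phi x * pd c b phi x.

(* Functions of (phi, X) are functions on 'rV_2, phi being the variable of
   index 0 and X that of index 1. *)
Definition phiX (x : M) : 'rV[R]_2 :=
  \row_(i < 2) if i == 0 then phi x else kinetic x.

Variable p : 'rV[R]_2 -> R.

Definition p_phi : M -> R := fun x => partial 0 p (phiX x).
Definition p_X : M -> R := fun x => partial 1 p (phiX x).

(* p is C^2 on an open set containing all the values taken by (phi, X). *)
Definition nonsingular_p : Prop :=
  exists U : set 'rV[R]_2, [/\ open U, Ck 2 U p & forall x, U (phiX x)].

Definition energy_momentum : components 2 := fun c I x =>
  p_X x * pd c (idx I 0%N) phi x * pd c (idx I 1%N) phi x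
  + p (phiX x) * g c I x.

Definition field_equation (E : components 2) : Prop :=
  forall c, atlas c -> forall x, chart_dom c x -> forall I,
    E c I x = 8 * pi * energy_momentum c I x.

Definition admissible : Prop :=
  forall v : vcomponents, vector_field v ->
  forall s : M, kinetic s = 0 -> lie v kinetic s = 0 -> lie v p_X s = 0.

Definition exceptional (xi : vcomponents) (s : M) : Prop :=
  [/\ p_phi s = 0, p_X s = 0 & lie xi p_X s = 0].

End Metric.

Definition integral_curve (v : vcomponents) (J : set R) (u : R -> M) : Prop :=
  [/\ open J, is_interval J
    & forall t, J t -> {for t, continuous u} /\
        forall c, atlas c -> chart_dom c (u t) -> forall i : 'I_D,
          is_derive t 1 (fun r => coord c i (u r)) (v c i (u t))].

(* The field v is not assumed to be complete. *)
Definition orbit_through (v : vcomponents) (s : M) : set M :=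
  [set y | exists (J : set R) (u : R -> M), integral_curve v J u /\
     exists t0 t, [/\ J t0, J t, u t0 = s & u t = y]].

Definition nonsingular_orbit (v : vcomponents) (O : set M) : Prop :=
  (exists s, O = orbit_through v s) /\
  forall x, O x -> exists i, v (chart_at x) i x <> 0.

End Tensors.

(* Main.v *)
(* The Lie derivative along the Killing field xi annihilates g, hence every
   polynomial in the curvature, so the field equation gives L_xi T = 0, that
   is, with f = L_xi phi,
     (L_xi p_X) d_a phi d_b phi + p_X (d_a f d_b phi + d_a phi d_b f)
       + (L_xi p) g_ab = 0.
   The trace and the contraction with nabla^a phi nabla^b phi give
   X L_xi p = 0.  Where X = 0, either L_xi X = 0 and the trace gives
   L_xi p = 0, or L_xi X <> 0 and differentiating X L_xi p = 0 along xi does.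
   Hence L_xi p = p_phi f + p_X L_xi X and X L_xi p_X + p_X L_xi X vanish
   everywhere, and the contraction with xi^a xi^b then gives
   (L_xi p_X) f^2 + 2 p_X f L_xi f = 0; (a)-(d) are algebraic consequences.
   In particular Y f = 0, so along an orbit with X p_X <> 0 the function f^2
   solves a linear equation h' = b h and vanishes identically or nowhere. *)
From HB Require Import structures.
Require Import Defs.
From mathcomp Require Import ring lra.
Set Implicit Arguments.
Unset Strict Implicit.
Unset Printing Implicit Defensive.
Local Open Scope classical_set_scope.
Local Open Scope ring_scope.

(** * Functions of several real variables *)

(** Invariance of the curvature polynomials is proved inside one fixed chart, as the identity [along
    c (xi c) t = - act (jac c (xi c)) t] between components. The left side is a derivation and the
    right side a gl(D) action, so sums, products and permutations are formal. The one non-tensorial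
    ingredient is the connection: its coefficients pick up second derivatives of [xi], which cancel
    in [nabla] and, by symmetry of mixed partials, in the curvature. Change of chart enters only for
    the scalars [lie] and [kinetic], defined through [chart_at]. As p is only C^2, smooth calculus
    covers g, xi and phi, while p, p_phi and p_X are handled as functions with first partial
    derivatives. The equation X L_xi p = 0 can still be differentiated, because L_xi p = p_phi f +
    p_X L_xi X. On an orbit f^2 is used because Y f = 0 says nothing about L_xi f at a zero of f,
    whereas the derivative of f^2 vanishes there anyway. If X p_X = 0, the equation is (f^2)' = 0: f
    vanishes on the whole curve, hence so does L_xi f, or nowhere, and then f L_xi f = 0 gives the
    claim. *)

Section Line.
Variable R : realType.

Lemma mean_value0 (g dg : R -> R) (s : R) :
  (forall t : R, `|t| <= `|s| -> is_derive t (1 : R) g (dg t)) ->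
  exists2 t, `|t| <= `|s| & g s - g 0 = dg t * s.
Proof.
move=> gd.
have gc a b : (forall t, a <= t <= b -> `|t| <= `|s|) ->
    {within `[a, b], continuous g}.
  move=> ab; apply: derivable_within_continuous => t /[!in_itv] /ab /gd.
  by move=> [].
have [s0|s0] := leP 0 s.
  have h t : 0 <= t <= s -> `|t| <= `|s|.
    by move=> /andP[t0 ts]; rewrite !ger0_norm.
  have [||t tI ->] := @MVT_segment _ g dg 0 s s0.
  - by move=> t /[!in_itv] /andP[t0 ts]; apply/gd/h; rewrite !ltW.
  - exact: gc.
  by exists t; [apply: h; move: tI; rewrite in_itv|rewrite subr0].
have h t : s <= t <= 0 -> `|t| <= `|s|.
  by move=> /andP[t0 ts]; rewrite !ler0_norm ?lerN2// ltW.
have [||t tI e] := @MVT_segment _ g dg s 0 (ltW s0).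
- by move=> t /[!in_itv] /andP[t0 ts]; apply/gd/h; rewrite !ltW.
- exact: gc.
exists t; first by apply: h; move: tI; rewrite in_itv.
by rewrite -opprB e sub0r mulrN opprK.
Qed.

Lemma is_derive_line (V : normedModType R) (f : V -> R) (x v : V) (t : R) :
  derivable f (x + t *: v) v ->
  is_derive t (1 : R) (fun s => f (x + s *: v)) ('D_v f (x + t *: v)).
Proof.
move=> /cvg_ex[l fl].
have fl' : h^-1 *: (((fun s => f (x + s *: v)) \o shift t) (h *: (1 : R)) -
    f (x + t *: v)) @[h --> 0^'] --> l.
  rewrite (_ : (fun h => _) =
    fun h => h^-1 *: ((f \o shift (x + t *: v)) (h *: v) - f (x + t *: v))) //.
  by apply/funext => h /=; rewrite [_ *: 1]mulr1 scalerDl addrCA.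
apply: DeriveDef; first by apply/cvg_ex; exists l.
by rewrite /derive (cvg_lim _ fl')// (cvg_lim _ fl).
Qed.

Lemma mean_value_line (V : normedModType R) (f : V -> R) (x v : V) (s : R) :
  (forall t, `|t| <= `|s| -> derivable f (x + t *: v) v) ->
  exists2 t, `|t| <= `|s| & f (x + s *: v) - f x = 'D_v f (x + t *: v) * s.
Proof.
move=> fd.
have [|t ts] := @mean_value0 (fun s => f (x + s *: v))
    (fun t => 'D_v f (x + t *: v)) s.
  by move=> t ts; apply/is_derive_line/fd.
by rewrite scale0r addr0; exists t.
Qed.

End Line.

(** * Closure properties of the classes C^k *)

Section Ck_theory.
Variables (R : realType) (n : nat).
Local Notation E := ('rV[R]_n).
Implicit Types (f g : E -> R) (A B : set E) (x : E).

Lemma near_open_eq A f g x : open A -> A x -> {in A, f =1 g} ->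
  \near x, f x = g x.
Proof.
move=> oA Ax fg; have := open_nbhs_nbhs (conj oA Ax).
by apply: filterS => y Ay; apply: fg; rewrite inE.
Qed.

Lemma near_eq_continuous (T : topologicalType) (f g : T -> R) (x : T) :
  (\near x, f x = g x) -> {for x, continuous f} -> {for x, continuous g}.
Proof.
move=> fg; rewrite /prop_for /continuous_at -(nbhs_singleton fg).
by apply: cvg_trans; apply: near_eq_cvg; apply: filterS fg => y ->.
Qed.

Lemma partial_ext A f g i : open A -> {in A, f =1 g} ->
  {in A, partial i f =1 partial i g}.
Proof.
move=> oA fg x /[!inE] Ax; apply: near_eq_derive.
exact: near_open_eq oA Ax fg.
Qed.

Lemma Ck_ext k A f g : open A -> {in A, f =1 g} -> Ck k A f -> Ck k A g.
Proof.
move=> oA; elim: k f g => [|k IHk] f g fg /= [fc fd].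
  by split=> // x Ax; apply: near_eq_continuous (fc x Ax);
    exact: near_open_eq oA Ax fg.
split=> [x Ax|i].
  by apply: near_eq_continuous (fc x Ax); exact: near_open_eq oA Ax fg.
have [fdi fCk] := fd i; split=> [x Ax|].
  exact: near_eq_derivable (near_open_eq oA Ax fg) (fdi x Ax).
by apply: IHk fCk; apply: partial_ext.
Qed.

Lemma CkW k A f : Ck k.+1 A f -> Ck k A f.
Proof.
elim: k f => [|k IHk] f [fc fd]; split=> // i.
by have [fdi /IHk] := fd i.
Qed.

Lemma Ck_continuous k A f x : Ck k A f -> A x -> {for x, continuous f}.
Proof. by case: k => [|k] [fc _]; apply: fc. Qed.

Lemma Ck_derivable k A f x i :
  Ck k.+1 A f -> A x -> derivable f x (delta_mx 0 i).
Proof. by move=> [_ fd]; apply: (fd i).1. Qed.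

Lemma Ck_partial k A f i : Ck k.+1 A f -> Ck k A (partial i f).
Proof. by move=> [_ fd]; apply: (fd i).2. Qed.

Lemma Ck_cst k A (a : R) : Ck k A (cst a).
Proof.
elim: k a => [|k IHk] a; (split; first by move=> x _; exact: cst_continuous) => // i.
split=> [x _|]; first exact: derivable_cst.
suff -> : partial i (cst a) = (cst 0 : E -> R) by [].
by apply/funext => x; rewrite /partial derive_cst.
Qed.

Lemma Ck_add k A f g : open A -> Ck k A f -> Ck k A g -> Ck k A (f + g).
Proof.
move=> oA; elim: k f g => [|k IHk] f g hf hg;
  (split; first by move=> x Ax; apply: continuousD;
    [exact: Ck_continuous hf Ax|exact: Ck_continuous hg Ax]) => // i.
split=> [x Ax|].
  by apply: derivableD; [exact: Ck_derivable hf Ax|exact: Ck_derivable hg Ax].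
apply: Ck_ext (IHk _ _ (Ck_partial i hf) (Ck_partial i hg)) => //.
move=> x /[!inE] Ax; rewrite /partial deriveD//; first exact: Ck_derivable hf Ax.
exact: Ck_derivable hg Ax.
Qed.

Lemma Ck_mul k A f g : open A -> Ck k A f -> Ck k A g -> Ck k A (f * g).
Proof.
move=> oA; elim: k f g => [|k IHk] f g hf hg;
  (split; first by move=> x Ax; apply: continuousM;
    [exact: Ck_continuous hf Ax|exact: Ck_continuous hg Ax]) => // i.
split=> [x Ax|].
  by apply: derivableM; [exact: Ck_derivable hf Ax|exact: Ck_derivable hg Ax].
have := Ck_add oA (IHk _ _ (CkW hf) (Ck_partial i hg))
                  (IHk _ _ (CkW hg) (Ck_partial i hf)).
apply: Ck_ext => // x /[!inE] Ax; rewrite /partial deriveM//.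
  exact: Ck_derivable hf Ax.
exact: Ck_derivable hg Ax.
Qed.

Lemma Ck_inv k A f : open A -> (forall x, A x -> f x != 0) -> Ck k A f ->
  Ck k A (fun x => (f x)^-1).
Proof.
move=> oA f0; elim: k => [|k IHk] hf;
  (split; first by move=> x Ax; apply: continuousV;
    [exact: f0|exact: Ck_continuous hf Ax]) => // i.
split=> [x Ax|].
  by apply: derivableV; [exact: f0|exact: Ck_derivable hf Ax].
have fV := IHk (CkW hf).
have := Ck_mul oA (Ck_mul oA (Ck_cst k A (-1)) (Ck_mul oA fV fV))
                  (Ck_partial i hf).
apply: Ck_ext => // x /[!inE] Ax; rewrite /partial deriveV ?f0//; last first.
  exact: Ck_derivable hf Ax.
by rewrite -exprVn expr2 /GRing.mul/= mulN1r.
Qed.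

End Ck_theory.

(** * Differentiability of C^1 functions, the chain rule, symmetry of second derivatives *)

Section Frechet.
Variable R : realType.

Lemma rV_norm_le n (x : 'rV[R]_n) (e : R) :
  0 <= e -> (forall i, `|x 0 i| <= e) -> `|x| <= e.
Proof.
move=> e0 xe; rewrite [leLHS]/Num.norm/= mx_normrE bigmax_le// => -[i j] _ /=.
by rewrite ord1.
Qed.

Lemma rV_coord_le n (x : 'rV[R]_n) i : `|x 0 i| <= `|x|.
Proof.
rewrite [leRHS]/Num.norm/= mx_normrE.
by apply: le_trans (le_bigmax _ _ (0, i)).
Qed.

Lemma norm_delta_le n (i : 'I_n) (t : R) :
  `|t *: (delta_mx 0 i : 'rV[R]_n)| <= `|t|.
Proof.
apply: rV_norm_le => // j; rewrite !mxE eqxx/=.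
by case: eqP => _; rewrite ?mulr1// mulr0 normr0.
Qed.

Lemma nbhs_norm_ball (V : normedModType R) (a : V) (P : set V) :
  nbhs a P -> exists2 r : R, 0 < r & forall y, `|y| < r -> P (a + y).
Proof.
move=> /nbhs_normP[r r0 rP]; exists r => // y yr; apply: rP.
by rewrite /ball_ /= opprD addNKr normrN.
Qed.

Lemma scaled_coord_continuous n (i : 'I_n) (a : R) :
  continuous (fun v : 'rV[R]_n => v 0 i * a).
Proof.
move=> v; apply: (@continuousM R 'rV[R]_n (fun v => v 0 i) (cst a) v).
  exact: differentiable_continuous (differentiable_coord _ _ _).
exact: cst_continuous.
Qed.

(** Uniqueness of the linear part ([diff_unique]) first identifies the chosen differential with [L];
    only then does the expansion say that [f] is differentiable. *)
Lemma differentiable_expansion (V : normedModType R) (f : V -> R)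
    (L : {linear V -> R}) a :
  continuous L ->
  (forall e, 0 < e -> exists2 r, 0 < r & forall h, `|h| < r ->
     `|f (a + h) - f a - L h| <= e * `|h|) ->
  differentiable f a /\ 'd f a = L :> (V -> R).
Proof.
move=> Lc fL; have fLo : f \o shift a = cst (f a) + L +o_ 0 id.
  apply/eqaddoP => e /fL[r r0 rP]; apply/nbhs_normP; exists r => // h /=.
  rewrite sub0r normrN => /rP.
  by rewrite -addrA -opprD [a + h]addrC.
have dE := diff_unique Lc fLo; split=> //.
by apply/diff_locallyP; rewrite dE.
Qed.

(** The increment from [a] to [a + h] is made one coordinate at a time. The mean value theorem turns
    each partial increment into a partial derivative at a point close to [a], and continuity of the
    partials bounds the error. *)
Lemma C1_differentiable n (U : set 'rV[R]_n) (f : 'rV[R]_n -> R) a :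
  open U -> U a -> Ck 1 U f ->
  differentiable f a /\
  forall v, 'd f a v = \sum_(i < n) v 0 i * partial i f a.
Proof.
move=> oU Ua fC.
pose L (v : 'rV[R]_n) : R := \sum_(i < n) v 0 i * partial i f a.
have Llin : linear L.
  move=> k u v; rewrite /L scaler_sumr -big_split; apply: eq_bigr => i _ /=.
  by rewrite !mxE mulrDl -mulrA.
pose LL : {linear 'rV[R]_n -> R} :=
  HB.pack L (GRing.isLinear.Build _ _ _ _ L Llin).
have Lc : continuous L.
  apply: continuous_big => [|i _ v]; first exact: add_continuous.
  exact: scaled_coord_continuous.
have [//||df dE] := @differentiable_expansion _ f LL a; last first.
  by split=> // v; rewrite dE.
move=> e e0.
(* The error allowed to each of the [n] partial increments; the successor keeps the denominator
   nonzero when [n] is 0. *)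
pose e' := e / n.+1%:R.
have e'0 : 0 < e' by rewrite divr_gt0.
have : nbhs a (fun y => U y /\
    forall i, `|partial i f y - partial i f a| <= e').
  apply: filterI; first exact: open_nbhs_nbhs.
  apply: (@filter_forall _ _ (fun i y => `|partial i f y - partial i f a| <= e')
    _ (nbhs_filter a)) => i.
  have /cvgr_distC_le := Ck_continuous (Ck_partial i fC) Ua; exact.
move=> /nbhs_norm_ball[r r0 rP].
exists r => // h hr.
(* [z k] keeps the first [k] coordinates of [h], so [z] goes from 0 to [h] and the increments of [f]
   telescope. *)
pose z k : 'rV[R]_n := \row_i if (i < k)%N then h 0 i else 0.
have zS (k : 'I_n) : z k.+1 = z k + h 0 k *: delta_mx 0 k.
  apply/rowP => i; rewrite !mxE eqxx/= ltnS leq_eqVlt -val_eqE/=.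
  by have [_|_|/val_inj ->] := ltngtP i k; rewrite /= ?mulr0 ?mulr1 ?addr0 ?add0r.
have zh (k : 'I_n) t : `|t| <= `|h 0 k| -> `|z k + t *: delta_mx 0 k| <= `|h|.
  move=> th; apply: rV_norm_le => // i; rewrite !mxE eqxx/= -val_eqE/=.
  have [_|_|_] := ltngtP i k; rewrite /= ?mulr1 ?mulr0 ?addr0 ?add0r.
  - exact: rV_coord_le.
  - by rewrite normr0.
  by rewrite (le_trans th)// rV_coord_le.
have step (k : 'I_n) : `|f (a + z k.+1) - f (a + z k) - h 0 k * partial k f a|
    <= e' * `|h|.
  rewrite zS addrA.
  have [t th|t th ->] := @mean_value_line R _ f (a + z k) (delta_mx 0 k) (h 0 k).
    have [Uy _] := rP (z k + t *: delta_mx 0 k) (le_lt_trans (zh _ _ th) hr).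
    by rewrite -addrA; exact: Ck_derivable fC Uy.
  rewrite -addrA.
  have [_ /(_ k) yk] := rP (z k + t *: delta_mx 0 k) (le_lt_trans (zh _ _ th) hr).
  rewrite mulrC -mulrBr normrM mulrC ler_pM//; exact: rV_coord_le.
have -> : f (a + h) - f a - LL h =
    \sum_(k < n) (f (a + z k.+1) - f (a + z k) - h 0 k * partial k f a).
  rewrite big_split/= sumrN.
  rewrite -(big_mkord xpredT (fun k => f (a + z k.+1) - f (a + z k))).
  rewrite telescope_sumr//.
  have -> : z n = h by apply/rowP => i; rewrite mxE ltn_ord.
  have -> : z 0%N = 0 by apply/rowP => i; rewrite !mxE.
  by rewrite addr0.
apply: le_trans (ler_norm_sum _ _ _) _.
apply: le_trans (ler_sum _ (fun k _ => step k)) _.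
rewrite sumr_const card_ord -mulrnAl ler_wpM2r//.
by rewrite -mulr_natr /e' mulrAC ler_pdivrMr// ler_pM2l// ler_nat.
Qed.

(** As [w] is only assumed derivable along [v], it is restricted to the line through [x]. On a
    function of one real variable derivability is differentiability, and composition with the
    differentiable [f] applies. *)
Lemma chain_rule (V : normedModType R) n (U : set 'rV[R]_n)
    (f : 'rV[R]_n -> R) (w : V -> 'rV[R]_n) x v :
  open U -> U (w x) -> Ck 1 U f ->
  (forall i, derivable (fun y => w y 0 i) x v) ->
  is_derive x v (f \o w)
    (\sum_(i < n) 'D_v (fun y => w y 0 i) x * partial i f (w x)).
Proof.
move=> oU Uw fC wd.
have dw : derivable w x v by apply/derivable_mxP => i j; rewrite ord1.
pose w' (h : R) := w (h *: v + x).
have w'0 : w' 0 = w x by rewrite /w' scale0r add0r.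
rewrite -[w x]w'0.
have Uw' : U (w' 0) by rewrite w'0.
have [df dE] := C1_differentiable oU Uw' fC.
have dw1 : derivable w' 0 (1 : R) by exact/(derivable1P w x v).1.
have dw' : differentiable w' 0 by exact/derivable1_diffP.
have dfw : differentiable (f \o w') 0 by exact: differentiable_comp.
have lineE (g : V -> R) : 'D_v g x = 'D_1 (fun h : R => g (h *: v + x)) 0.
  rewrite /derive; set g1 := fun h => h^-1 *: _; set g2 := fun h => h^-1 *: _.
  suff -> : g1 = g2 by [].
  by rewrite funeqE /g1 /g2 => h /=; rewrite addr0 scale0r add0r [_ *: 1]mulr1.
apply: DeriveDef.
  by apply/derivable1P; exact/(derivable1_diffP _ _).2.
have -> : 'D_v (f \o w) x = 'd (f \o w') 0 (1 : R).
  by rewrite lineE deriveE.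
have -> : 'd (f \o w') 0 (1 : R) = 'd f (w' 0) ('d w' 0 (1 : R)).
  by rewrite diff_comp.
rewrite dE; apply: eq_bigr => i _; congr (_ * _).
by rewrite -deriveE// derive_mx// mxE lineE.
Qed.

Let no_close (a b c : R) :
  `|c - a| < `|a - b| / 2 -> `|c - b| < `|a - b| / 2 -> False.
Proof.
move=> h1 h2; have := ltrD h1 h2; rewrite -splitr ltNge => /negP; apply.
by rewrite [`|c - a|]distrC (le_trans _ (ler_normD _ _))// addrA subrK.
Qed.

(** The second difference of [f] over a small square is symmetric in the two directions. Two mean
    value steps, taken in either order, express it by either mixed partial at a nearby point; were
    the partials [d] apart at [x], both could not stay within [d / 2] of their values there. *)
Lemma partialC n (U : set 'rV[R]_n) (f : 'rV[R]_n -> R) x i j :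
  open U -> U x -> Ck 2 U f ->
  partial i (partial j f) x = partial j (partial i f) x.
Proof.
move=> oU Ux fC; apply/eqP; rewrite -subr_eq0; apply/negP => /negP.
rewrite -normr_gt0; set d := `| _ | => d0.
pose P k l := fun y => `|partial k (partial l f) y - partial k (partial l f) x| < d / 2.
have PP k l : nbhs x (P k l).
  have /cvgr_distC_lt := Ck_continuous (Ck_partial k (Ck_partial l fC)) Ux.
  by apply; rewrite divr_gt0.
have : nbhs x (fun y => [/\ U y, P i j y & P j i y]).
  have oUx := open_nbhs_nbhs (conj oU Ux).
  by have := PP i j; have := PP j i; apply: filterS3 oUx => y.
move=> /nbhs_norm_ball[r r0 rP].
(* Two increments of size at most [s] then add up to less than [r]. *)
pose s := r / 3.
have s0 : 0 < s by rewrite divr_gt0.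
have inr a b k l : `|a| <= `|s| -> `|b| <= `|s| ->
    `|a *: (delta_mx 0 k : 'rV[R]_n) + b *: delta_mx 0 l| < r.
  rewrite [`|s|]gtr0_norm// => sa sb.
  apply: le_lt_trans (ler_normD _ _) _.
  apply: le_lt_trans (lerD (norm_delta_le _ _) (norm_delta_le _ _)) _.
  by apply: le_lt_trans (lerD sa sb) _; rewrite /s; lra.
(* The first mean value step is taken along [k] for the difference [g] of [f] across the square in
   direction [l], the second along [l] for [partial k f]. *)
have second k l : exists a b, [/\ `|a| <= `|s|, `|b| <= `|s| &
   f (x + s *: delta_mx 0 k + s *: delta_mx 0 l) - f (x + s *: delta_mx 0 k)
   - (f (x + s *: delta_mx 0 l) - f x) =
   partial l (partial k f) (x + (a *: delta_mx 0 k + b *: delta_mx 0 l)) * s * s].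
  pose g y := f (y + s *: delta_mx 0 l) - f y.
  have gd t : `|t| <= `|s| -> is_derive (x + t *: delta_mx 0 k) (delta_mx 0 k) g
      (partial k f (x + t *: delta_mx 0 k + s *: delta_mx 0 l) -
       partial k f (x + t *: delta_mx 0 k)).
    move=> ts; apply: is_deriveB; last first.
      apply: derivableP; apply: Ck_derivable fC _.
      have [] := rP (t *: delta_mx 0 k + 0 *: delta_mx 0 l).
        by apply: inr => //; rewrite normr0.
      by rewrite scale0r addr0.
    have /derivableP fd' : derivable f
        (x + t *: delta_mx 0 k + s *: delta_mx 0 l) (delta_mx 0 k).
      apply: Ck_derivable fC _; rewrite -addrA.
      by have [] := rP (t *: delta_mx 0 k + s *: delta_mx 0 l) (inr _ _ _ _ ts (lexx _)).
    case: fd' => fd' fE; rewrite /partial; set y := x + _ in fd' fE *.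
    have sh : (fun h => h^-1 *: ((f \o shift (y + s *: delta_mx 0 l))
          (h *: delta_mx 0 k) - f (y + s *: delta_mx 0 l))) =
        (fun h => h^-1 *: (((fun y => f (y + s *: delta_mx 0 l)) \o shift y)
          (h *: delta_mx 0 k) - f (y + s *: delta_mx 0 l))).
      by apply/funext => h /=; rewrite addrA.
    by apply: DeriveDef; rewrite /derivable /derive -sh.
  have [t /gd[]//|a sa] := @mean_value_line R _ g x (delta_mx 0 k) s.
  rewrite (@derive_val _ _ _ _ _ _ _ (gd a sa)) => e.
  have [t ts|b sb eb] := @mean_value_line R _ (partial k f)
      (x + a *: delta_mx 0 k) (delta_mx 0 l) s.
    apply: Ck_derivable (Ck_partial k fC) _; rewrite -addrA.
    by have [] := rP (a *: delta_mx 0 k + t *: delta_mx 0 l) (inr _ _ _ _ sa ts).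
  exists a, b; split=> //.
  by move: e; rewrite eb /g => ->; rewrite addrA.
have [a [b [sa sb e1]]] := second i j.
have [a' [b' [sa' sb' e2]]] := second j i.
have : partial j (partial i f) (x + (a *: delta_mx 0 i + b *: delta_mx 0 j)) =
       partial i (partial j f) (x + (a' *: delta_mx 0 j + b' *: delta_mx 0 i)).
  apply: (mulIf (lt0r_neq0 s0)); apply: (mulIf (lt0r_neq0 s0)).
  apply: etrans (esym e1) (etrans _ e2).
  rewrite (addrAC x (s *: delta_mx 0 i)) !opprB.
  by rewrite addrACA [RHS]addrACA; congr (_ + _); exact: addrC.
have [_ _] := rP _ (inr _ _ i j sa sb).
have [_ + _] := rP _ (inr _ _ j i sa' sb').
by rewrite /P => h1 h2 e; rewrite e in h2; exact: no_close h1 h2.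
Qed.

End Frechet.

(** * Partial derivatives in a chart *)

(* Locked, as comparing two distinct derivatives by unfolding diverges. *)
HB.lock Definition pder := @pd.
Arguments pder {R D T} c i f _.

Section PartialDerivatives.
Variables (R : realType) (D : nat) (T : topologicalType) (c : chart R D T).
Implicit Types (f g : T -> R) (x y : T).
Local Notation U := (chart_dom c).
Local Notation sm := (chart_smooth c U).

Lemma chart_invK z : (c @` U) z -> U (chart_inv c z) /\ c (chart_inv c z) = z.
Proof. by move=> [x Ux <-]; rewrite chart_funK. Qed.

Lemma pd_inv i f z : (c @` U) z ->
  pd c i f (chart_inv c z) = partial i (f \o chart_inv c) z.
Proof. by move=> /chart_invK[_ E]; rewrite /pd E. Qed.

Lemma image_dom x : U x -> (c @` U) (c x).
Proof. by move=> Ux; exists x. Qed.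
Hint Resolve image_dom : core.

Let oW : open (c @` U) := @chart_cod_open _ _ _ c.

Lemma chart_eq f g : {in U, f =1 g} ->
  {in c @` U, f \o chart_inv c =1 g \o chart_inv c}.
Proof.
by move=> fg z /[!inE] /chart_invK[Uz _] /=; apply: fg; rewrite inE.
Qed.

Lemma pderE i f x : pder c i f x = pd c i f x.
Proof. by rewrite unlock. Qed.

Lemma pd_ext f g i x : {in U, f =1 g} -> U x -> pder c i f x = pder c i g x.
Proof.
rewrite unlock => fg Ux; have /(partial_ext i oW) := chart_eq fg; apply.
by rewrite inE; exists x.
Qed.

Lemma sm_ext f g : {in U, f =1 g} -> sm f -> sm g.
Proof. by move=> /chart_eq fg fs k; apply: Ck_ext (fs k). Qed.

Lemma sm_pd i f : sm f -> sm (pder c i f).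
Proof.
rewrite unlock => fs k; apply: Ck_ext (Ck_partial i (fs k.+1)) => // z /[!inE] Wz.
by rewrite [RHS]pd_inv.
Qed.

Lemma sm_cst (a : R) : sm (fun=> a).
Proof. by move=> k; apply: Ck_cst. Qed.

Lemma sm_add f g : sm f -> sm g -> sm (fun x => f x + g x).
Proof. by move=> fs gs k; exact: (Ck_add oW (fs k) (gs k)). Qed.

Lemma sm_mul f g : sm f -> sm g -> sm (fun x => f x * g x).
Proof. by move=> fs gs k; exact: (Ck_mul oW (fs k) (gs k)). Qed.

Lemma sm_opp f : sm f -> sm (fun x => - f x).
Proof.
move=> /(sm_mul (sm_cst (-1))); apply: sm_ext => x _.
by rewrite mulN1r.
Qed.

Lemma sm_sum (I : Type) (r : seq I) (P : pred I) (F : I -> T -> R) :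
  (forall i, sm (F i)) -> sm (fun x => \sum_(i <- r | P i) F i x).
Proof.
move=> Fs; elim: r => [|a r IHr].
  by apply: sm_ext (sm_cst 0) => x _; rewrite big_nil.
case Pa : (P a).
  by apply: sm_ext (sm_add (Fs a) IHr) => x _; rewrite big_cons Pa.
by apply: sm_ext IHr => x _; rewrite big_cons Pa.
Qed.

Lemma sm_prod (I : Type) (r : seq I) (P : pred I) (F : I -> T -> R) :
  (forall i, sm (F i)) -> sm (fun x => \prod_(i <- r | P i) F i x).
Proof.
move=> Fs; elim: r => [|a r IHr].
  by apply: sm_ext (sm_cst 1) => x _; rewrite big_nil.
case Pa : (P a).
  by apply: sm_ext (sm_mul (Fs a) IHr) => x _; rewrite big_cons Pa.
by apply: sm_ext IHr => x _; rewrite big_cons Pa.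
Qed.

Lemma sm_inv f : (forall x, U x -> f x != 0) -> sm f -> sm (fun x => (f x)^-1).
Proof.
move=> f0 fs k; apply: (@Ck_inv _ _ _ _ (f \o chart_inv c)) => //.
  by move=> z /chart_invK[Uz _]; apply: f0.
exact: fs.
Qed.

(** The regularity available for [p], [p_phi] and [p_X] as functions on the manifold, which are not
    smooth because [p] is only C^2. *)
Definition pderivable f x :=
  forall i, derivable (f \o chart_inv c) (c x) (delta_mx 0 i).

Lemma sm_pderivable f x : sm f -> U x -> pderivable f x.
Proof. move=> fs Ux i; have f1 : Ck 1 (c @` U) (f \o chart_inv c) := fs 1%N.
exact: Ck_derivable f1 (image_dom Ux). Qed.

Lemma pd_cst i (a : R) x : pder c i (fun=> a) x = 0.
Proof. by rewrite unlock; exact: derive_cst. Qed.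

Lemma pd_add i f g x : pderivable f x -> pderivable g x ->
  pder c i (fun y => f y + g y) x = pder c i f x + pder c i g x.
Proof. by rewrite unlock => fd gd; apply: deriveD. Qed.

Lemma pd_mul i f g x : U x -> pderivable f x -> pderivable g x ->
  pder c i (fun y => f y * g y) x = pder c i f x * g x + f x * pder c i g x.
Proof.
rewrite unlock => Ux fd gd; have fd' := fd i; have gd' := gd i.
have -> : pd c i (fun y => f y * g y) x =
    (f \o chart_inv c) (c x) *: pd c i g x + (g \o chart_inv c) (c x) *: pd c i f x.
  by rewrite -(deriveM fd' gd').
rewrite /= chart_funK// addrC; congr (_ + _); exact: mulrC.
Qed.

Lemma pderivable_cst (a : R) x : pderivable (fun=> a) x.
Proof. by move=> i; exact: derivable_cst. Qed.

Lemma pderivable_add f g x : pderivable f x -> pderivable g x ->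
  pderivable (fun y => f y + g y) x.
Proof. by move=> fd gd i; apply: derivableD. Qed.

Lemma pderivable_mul f g x : pderivable f x -> pderivable g x ->
  pderivable (fun y => f y * g y) x.
Proof. by move=> fd gd i; apply: derivableM. Qed.

Lemma pdC i j f x : U x -> sm f -> pder c i (pder c j f) x = pder c j (pder c i f) x.
Proof.
rewrite unlock => Ux fs; have Wx := image_dom Ux.
have pdd k l : pd c k (pd c l f) x = partial k (partial l (f \o chart_inv c)) (c x).
  apply: (partial_ext k oW); last by rewrite inE.
  by move=> z; rewrite inE => Wz; exact: pd_inv.
by rewrite !pdd; apply: partialC oW Wx (fs 2%N).
Qed.

(* Both [pder c i ^~ x] and the directional derivative along a vector field are
   derivations in this sense. *)
Record derivation_at x (dl : (T -> R) -> R) : Prop := {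
  dl_ext : forall f g, {in U, f =1 g} -> dl f = dl g;
  dl_add : forall f g, sm f -> sm g ->
    dl (fun y => f y + g y) = dl f + dl g;
  dl_mul : forall f g, sm f -> sm g ->
    dl (fun y => f y * g y) = dl f * g x + f x * dl g;
  dl_cst : forall a, dl (fun=> a) = 0
}.

Lemma derivation_pd i x : U x -> derivation_at x (fun f => pder c i f x).
Proof.
move=> Ux; split=> [f g fg|f g fs gs|f g fs gs|a].
- exact: pd_ext.
- by apply: pd_add; apply: sm_pderivable.
- by apply: pd_mul => //; apply: sm_pderivable.
exact: pd_cst.
Qed.

Definition along (w : 'I_D -> T -> R) f x := \sum_(d < D) w d x * pder c d f x.

Lemma derivation_along (w : 'I_D -> T -> R) x :
  U x -> derivation_at x (fun f => along w f x).
Proof.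
move=> Ux; split=> [f g fg|f g fs gs|f g fs gs|a]; rewrite /along.
- by apply: eq_bigr => d _; rewrite (pd_ext _ fg).
- rewrite -big_split; apply: eq_bigr => d _ /=.
  by rewrite (dl_add (derivation_pd d Ux))// mulrDr.
- rewrite mulr_suml mulr_sumr -big_split; apply: eq_bigr => d _ /=.
  by rewrite (dl_mul (derivation_pd d Ux))//; ring.
by rewrite big1// => d _; rewrite pd_cst mulr0.
Qed.

Lemma sm_along (w : 'I_D -> T -> R) f : (forall d, sm (w d)) -> sm f ->
  sm (along w f).
Proof. by move=> ws fs; apply: sm_sum => d; apply: sm_mul => //; apply: sm_pd. Qed.

Section Derivation.
Variables (x : T) (dl : (T -> R) -> R) (dld : derivation_at x dl).

Lemma dl_sum (I : Type) (r : seq I) (P : pred I) (F : I -> T -> R) :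
  (forall i, sm (F i)) ->
  dl (fun y => \sum_(i <- r | P i) F i y) = \sum_(i <- r | P i) dl (F i).
Proof.
move=> Fs; elim: r => [|a r IHr].
  rewrite big_nil -[RHS](dl_cst dld 0).
  by apply: (dl_ext dld) => y _; rewrite big_nil.
rewrite big_cons; case Pa : (P a).
  rewrite -IHr -(dl_add dld)//; last exact: sm_sum.
  by apply: (dl_ext dld) => y _; rewrite big_cons Pa.
by rewrite -IHr; apply: (dl_ext dld) => y _; rewrite big_cons Pa.
Qed.

Lemma dl_scale (a : R) f : sm f -> dl (fun y => a * f y) = a * dl f.
Proof.
by move=> fs; rewrite (dl_mul dld (sm_cst a) fs) (dl_cst dld) mul0r add0r.
Qed.

Lemma dl_opp f : sm f -> dl (fun y => - f y) = - dl f.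
Proof.
move=> fs; rewrite -mulN1r -dl_scale//.
by apply: (dl_ext dld) => y _; rewrite mulN1r.
Qed.

Lemma dl_sub f g : sm f -> sm g -> dl (fun y => f y - g y) = dl f - dl g.
Proof. by move=> fs gs; rewrite (dl_add dld fs (sm_opp gs)) dl_opp. Qed.

End Derivation.

(** The second-order terms cancel by symmetry of mixed partials, so the commutator of [w] with a
    coordinate derivative is of first order. *)
Lemma along_pd (w : 'I_D -> T -> R) f i x :
  U x -> (forall d, sm (w d)) -> sm f ->
  along w (pder c i f) x =
  pder c i (along w f) x - \sum_(d < D) pder c i (w d) x * pder c d f x.
Proof.
move=> Ux ws fs; rewrite {2}/along.
rewrite (dl_sum (derivation_pd i Ux)); last first.
  by move=> d; apply: sm_mul => //; apply: sm_pd.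
under eq_bigr => d _ do rewrite (dl_mul (derivation_pd i Ux) (ws d) (sm_pd d fs)).
rewrite big_split/= addrC addrK; apply: eq_bigr => d _.
by rewrite pdC.
Qed.

End PartialDerivatives.

(** * Tensor indices *)

Section IndexOperators.
Variables (R : comNzRingType) (D : nat).
Implicit Types (B C : 'M[R]_D).

Lemma tnth_set_idx n (I : n.-tuple 'I_D) k d j :
  tnth (set_idx I k d) j = if j == k then d else tnth I j.
Proof. by rewrite tnth_mktuple. Qed.

Lemma set_idx_idem n (I : n.-tuple 'I_D) k d e :
  set_idx (set_idx I k d) k e = set_idx I k e.
Proof.
by apply: eq_from_tnth => j; rewrite !tnth_set_idx; case: eqP.
Qed.

Lemma set_idxC n (I : n.-tuple 'I_D) k l d e : k != l ->
  set_idx (set_idx I k d) l e = set_idx (set_idx I l e) k d.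
Proof.
move=> kl; apply: eq_from_tnth => j; rewrite !tnth_set_idx.
by case: (j =P l) => // ->; rewrite eq_sym (negbTE kl).
Qed.

(* The action of gl(D) on covariant tensors. *)
Definition act n B (t : n.-tuple 'I_D -> R) (I : n.-tuple 'I_D) : R :=
  \sum_(k < n) \sum_(d < D) t (set_idx I k d) * B (tnth I k) d.

Let slot n B k (t : n.-tuple 'I_D -> R) I : R :=
  \sum_(d < D) t (set_idx I k d) * B (tnth I k) d.

Let slotM n B C k (t : n.-tuple 'I_D -> R) I :
  slot B k (slot C k t) I = slot (B *m C) k t I.
Proof.
rewrite /slot; under eq_bigr do rewrite mulr_suml.
rewrite exchange_big; apply: eq_bigr => e _ /=; rewrite mxE mulr_sumr.
apply: eq_bigr => d _; rewrite set_idx_idem tnth_set_idx eqxx; ring.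
Qed.

Let slotC n B C k l (t : n.-tuple 'I_D -> R) I : k != l ->
  slot B k (slot C l t) I = slot C l (slot B k t) I.
Proof.
move=> kl; rewrite /slot; under eq_bigr do rewrite mulr_suml.
under [RHS]eq_bigr do rewrite mulr_suml.
rewrite exchange_big; apply: eq_bigr => e _; apply: eq_bigr => d _ /=.
rewrite (set_idxC _ _ _ kl) !tnth_set_idx [l == k]eq_sym (negbTE kl); ring.
Qed.

Lemma eq_act n B (t s : n.-tuple 'I_D -> R) I : t =1 s -> act B t I = act B s I.
Proof.
by move=> ts; apply: eq_bigr => k _; apply: eq_bigr => d _; rewrite ts.
Qed.

Lemma act_addl n B C (t : n.-tuple 'I_D -> R) I :
  act (B + C) t I = act B t I + act C t I.
Proof.
rewrite -big_split; apply: eq_bigr => k _; rewrite -big_split.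
by apply: eq_bigr => d _; rewrite mxE mulrDr.
Qed.

Lemma act_scalel n a B (t : n.-tuple 'I_D -> R) I :
  act (a *: B) t I = a * act B t I.
Proof.
rewrite mulr_sumr; apply: eq_bigr => k _; rewrite mulr_sumr.
by apply: eq_bigr => d _; rewrite mxE; ring.
Qed.

Lemma act_oppl n B (t : n.-tuple 'I_D -> R) I : act (- B) t I = - act B t I.
Proof. by rewrite -scaleN1r act_scalel mulN1r. Qed.

Lemma act_suml n (J : Type) (r : seq J) (F : J -> 'M[R]_D)
    (t : n.-tuple 'I_D -> R) I :
  act (\sum_(j <- r) F j) t I = \sum_(j <- r) act (F j) t I.
Proof.
elim: r => [|a r IHr]; last by rewrite !big_cons act_addl IHr.
by rewrite !big_nil -(scale0r 0) act_scalel mul0r.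
Qed.

Lemma act_addr n B (t s : n.-tuple 'I_D -> R) I :
  act B (fun J => t J + s J) I = act B t I + act B s I.
Proof.
rewrite -big_split; apply: eq_bigr => k _; rewrite -big_split.
by apply: eq_bigr => d _; rewrite mulrDl.
Qed.

Lemma act_scaler n a B (t : n.-tuple 'I_D -> R) I :
  act B (fun J => a * t J) I = a * act B t I.
Proof.
rewrite mulr_sumr; apply: eq_bigr => k _; rewrite mulr_sumr.
by apply: eq_bigr => d _; rewrite mulrA.
Qed.

Lemma act_oppr n B (t : n.-tuple 'I_D -> R) I :
  act B (fun J => - t J) I = - act B t I.
Proof.
by rewrite -mulN1r -act_scaler; apply: eq_act => J; rewrite mulN1r.
Qed.

(** Actions on two distinct indices commute, so only the terms with both matrices on the same index
    survive, and there the actions compose as the matrices do. *)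
Lemma act_comm n B C (t : n.-tuple 'I_D -> R) I :
  act B (act C t) I - act C (act B t) I = act (B *m C - C *m B) t I.
Proof.
have actM B' C' : act B' (act C' t) I =
    \sum_k \sum_l slot B' k (slot C' l t) I.
  apply: eq_bigr => k _; rewrite /slot exchange_big.
  by apply: eq_bigr => d _; rewrite mulr_suml.
rewrite !actM [X in _ - X]exchange_big act_addl act_oppl /act.
rewrite -2!sumrB; apply: eq_bigr => k _.
rewrite -sumrB (bigD1 k)//= big1 => [|l lk]; last first.
  by rewrite slotC ?subrr// eq_sym.
by rewrite addr0 !slotM.
Qed.

Lemma act_cons n B (t : n.+1.-tuple 'I_D -> R) i (J : n.-tuple 'I_D) :
  act B t [tuple of i :: J] =
  \sum_(d < D) t [tuple of d :: J] * B i d +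
  act B (fun J' => t [tuple of i :: J']) J.
Proof.
rewrite /act big_ord_recl; congr (_ + _).
  rewrite tnth0; apply: eq_bigr => d _; congr (t _ * _).
  apply: eq_from_tnth => j; rewrite tnth_set_idx.
  by case: (unliftP ord0 j) => [j'|] ->; rewrite ?tnth0 ?tnthS.
apply: eq_bigr => k _; rewrite tnthS; apply: eq_bigr => d _; congr (t _ * _).
apply: eq_from_tnth => j; rewrite tnth_set_idx.
case: (unliftP ord0 j) => [j'|] ->; rewrite ?tnth0 ?tnthS//.
by rewrite tnth_set_idx (inj_eq lift_inj).
Qed.

Lemma act0 B (t : 0.-tuple 'I_D -> R) I : act B t I = 0.
Proof. by rewrite /act big_ord0. Qed.

Lemma act2 B (t : 2.-tuple 'I_D -> R) a b :
  act B t [tuple a; b] =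
  \sum_(d < D) (t [tuple d; b] * B a d + t [tuple a; d] * B b d).
Proof.
have -> : [tuple a; b] = [tuple of a :: [tuple b]] by apply: val_inj.
have -> : [tuple b] = [tuple of b :: [tuple]] by apply: val_inj.
rewrite !act_cons act0 addr0 -big_split; apply: eq_bigr => d _.
by congr (t _ * _ + t _ * _); apply: val_inj.
Qed.

Lemma act4 B (t : 4.-tuple 'I_D -> R) i0 i1 i2 i3 :
  act B t [tuple i0; i1; i2; i3] = \sum_(d < D)
   (t [tuple d; i1; i2; i3] * B i0 d + t [tuple i0; d; i2; i3] * B i1 d +
    t [tuple i0; i1; d; i3] * B i2 d + t [tuple i0; i1; i2; d] * B i3 d).
Proof.
have -> : [tuple i0; i1; i2; i3] =
    [tuple of i0 :: [tuple of i1 :: [tuple of i2 :: [tuple of i3 :: [tuple]]]]].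
  exact: val_inj.
rewrite !act_cons act0 addr0 -!big_split; apply: eq_bigr => d _ /=.
by rewrite !addrA; congr (t _ * _ + t _ * _ + t _ * _ + t _ * _); apply: val_inj.
Qed.

Lemma act_perm n B (t : n.-tuple 'I_D -> R) (s : 'S_n) I :
  act B (fun J => t [tuple tnth J (s j) | j < n]) I =
  act B t [tuple tnth I (s j) | j < n].
Proof.
rewrite /act [RHS](reindex_inj (@perm_inj _ s^-1%g)); apply: eq_bigr => k _.
apply: eq_bigr => d _; rewrite tnth_mktuple permKV; congr (t _ * _).
apply: eq_from_tnth => j; rewrite tnth_mktuple !tnth_set_idx tnth_mktuple.
by rewrite (canF_eq (permK s)).
Qed.

Lemma act_mul m n B (t : m.-tuple 'I_D -> R) (s : n.-tuple 'I_D -> R)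
    (I : (m + n).-tuple 'I_D) :
  let l (J : (m + n).-tuple 'I_D) := [tuple tnth J (lshift n j) | j < m] in
  let r (J : (m + n).-tuple 'I_D) := [tuple tnth J (rshift m j) | j < n] in
  act B (fun J => t (l J) * s (r J)) I =
  act B t (l I) * s (r I) + t (l I) * act B s (r I).
Proof.
move=> l r; rewrite /act big_split_ord/= mulr_suml mulr_sumr; congr (_ + _).
  apply: eq_bigr => k _; rewrite mulr_suml; apply: eq_bigr => d _.
  have -> : l (set_idx I (lshift n k) d) = set_idx (l I) k d.
    apply: eq_from_tnth => j; rewrite tnth_mktuple !tnth_set_idx.
    by rewrite tnth_mktuple (inj_eq (@lshift_inj _ _)).
  have -> : r (set_idx I (lshift n k) d) = r I.
    apply: eq_from_tnth => j; rewrite !tnth_mktuple.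
    by rewrite eq_rlshift.
  by rewrite [tnth (l I) k]tnth_mktuple mulrAC.
apply: eq_bigr => k _; rewrite mulr_sumr; apply: eq_bigr => d _.
have -> : r (set_idx I (rshift m k) d) = set_idx (r I) k d.
  apply: eq_from_tnth => j; rewrite tnth_mktuple !tnth_set_idx.
  by rewrite tnth_mktuple (inj_eq (@rshift_inj _ _)).
have -> : l (set_idx I (rshift m k) d) = l I.
  apply: eq_from_tnth => j; rewrite !tnth_mktuple.
  by rewrite eq_lrshift.
by rewrite [tnth (r I) k]tnth_mktuple mulrA.
Qed.

End IndexOperators.

(** * Derivations of matrices *)

Section MatrixDerivation.
Variables (R : realType) (D : nat) (T : topologicalType) (c : chart R D T).
Local Notation U := (chart_dom c).
Local Notation sm := (chart_smooth c U).

Definition smM m n (B : T -> 'M[R]_(m, n)) := forall i j, sm (fun y => B y i j).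

Lemma smM_mul m n p (B : T -> 'M[R]_(m, n)) (C : T -> 'M[R]_(n, p)) :
  smM B -> smM C -> smM (fun y => B y *m C y).
Proof.
move=> Bs Cs i j; apply: (@sm_ext _ _ _ _ (fun y => \sum_k B y i k * C y k j)).
  by move=> y _; rewrite mxE.
by apply: sm_sum => k; apply: sm_mul.
Qed.

Lemma smM_add m n (B C : T -> 'M[R]_(m, n)) :
  smM B -> smM C -> smM (fun y => B y + C y).
Proof.
move=> Bs Cs i j; apply: (@sm_ext _ _ _ _ (fun y => B y i j + C y i j)).
  by move=> y _; rewrite mxE.
exact: sm_add.
Qed.

Lemma smM_opp m n (B : T -> 'M[R]_(m, n)) : smM B -> smM (fun y => - B y).
Proof.
move=> Bs i j; apply: (@sm_ext _ _ _ _ (fun y => - B y i j)).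
  by move=> y _; rewrite mxE.
exact: sm_opp.
Qed.

Lemma sm_det n (B : T -> 'M[R]_n) : smM B -> sm (fun y => \det (B y)).
Proof.
move=> Bs; apply: sm_sum => s; apply: sm_mul; first exact: sm_cst.
by apply: sm_prod => i.
Qed.

(** By Cramer's rule each entry of the inverse is a polynomial in the entries of [B] divided by the
    nonvanishing determinant. *)
Lemma smM_inv n (B : T -> 'M[R]_n) :
  (forall y, U y -> B y \in unitmx) -> smM B -> smM (fun y => invmx (B y)).
Proof.
move=> Bu Bs i j.
apply: (@sm_ext _ _ _ _ (fun y => (\det (B y))^-1 *
    ((-1) ^+ (j + i) * \det (row' j (col' i (B y)))))).
  by move=> y /[!inE] Uy; rewrite /invmx Bu// !mxE.
apply: sm_mul; first by apply: sm_inv (sm_det Bs) => y /Bu; rewrite unitmxE unitfE.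
apply: sm_mul; first exact: sm_cst.
apply: sm_det => k l; apply: sm_ext (Bs (lift j k) (lift i l)) => y _.
by rewrite !mxE.
Qed.

Definition dlM m n (dl : (T -> R) -> R) (B : T -> 'M[R]_(m, n)) : 'M[R]_(m, n) :=
  \matrix_(i, j) dl (fun y => B y i j).

Section At.
Variables (x : T) (dl : (T -> R) -> R) (dld : derivation_at c x dl).

Lemma dlM_ext m n (B C : T -> 'M[R]_(m, n)) : {in U, B =1 C} -> dlM dl B = dlM dl C.
Proof.
by move=> BC; apply/matrixP => i j; rewrite !mxE; apply: (dl_ext dld) => y Uy; rewrite BC.
Qed.

Lemma dlM_add m n (B C : T -> 'M[R]_(m, n)) : smM B -> smM C ->
  dlM dl (fun y => B y + C y) = dlM dl B + dlM dl C.
Proof.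
move=> Bs Cs; apply/matrixP => i j; rewrite !mxE -(dl_add dld)//.
by apply: (dl_ext dld) => y _; rewrite mxE.
Qed.

Lemma dlM_opp m n (B : T -> 'M[R]_(m, n)) : smM B ->
  dlM dl (fun y => - B y) = - dlM dl B.
Proof.
move=> Bs; apply/matrixP => i j; rewrite !mxE -(dl_opp dld)//.
by apply: (dl_ext dld) => y _; rewrite mxE.
Qed.

Lemma dlM_cst m n (B : 'M[R]_(m, n)) : dlM dl (fun=> B) = 0.
Proof. by apply/matrixP => i j; rewrite !mxE (dl_cst dld). Qed.

Lemma dlM_mul m n p (B : T -> 'M[R]_(m, n)) (C : T -> 'M[R]_(n, p)) :
  smM B -> smM C ->
  dlM dl (fun y => B y *m C y) = dlM dl B *m C x + B x *m dlM dl C.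
Proof.
move=> Bs Cs; apply/matrixP => i j; rewrite !mxE.
rewrite (dl_ext dld (g := fun y => \sum_k B y i k * C y k j)); last first.
  by move=> y _; rewrite mxE.
rewrite (dl_sum dld) => [|k]; last exact: sm_mul.
rewrite -big_split; apply: eq_bigr => k _ /=; rewrite !mxE.
by rewrite (dl_mul dld).
Qed.

(** Obtained by differentiating the product of the inverse with [B], which is constant on the
    chart. *)
Lemma dlM_inv n (B : T -> 'M[R]_n) : U x ->
  (forall y, U y -> B y \in unitmx) -> smM B ->
  dlM dl (fun y => invmx (B y)) = - (invmx (B x) *m dlM dl B *m invmx (B x)).
Proof.
move=> Ux Bu Bs; have Vs := smM_inv Bu Bs.
have : dlM dl (fun y => invmx (B y) *m B y) = 0.
  rewrite -[RHS](dlM_cst (1%:M : 'M[R]_n)); apply: dlM_ext => y /[!inE] /Bu By.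
  by rewrite mulVmx.
rewrite dlM_mul// => /(congr1 (mulmxr (invmx (B x)))) /=.
rewrite mulmxDl mul0mx mulmxK ?Bu// => /eqP.
by rewrite addr_eq0 => /eqP.
Qed.

Lemma dl_act n (t : n.-tuple 'I_D -> T -> R) (B : T -> 'M[R]_D) I :
  (forall J, sm (t J)) -> smM B ->
  dl (fun y => act (B y) (fun J => t J y) I) =
  act (B x) (fun J => dl (t J)) I + act (dlM dl B) (fun J => t J x) I.
Proof.
move=> ts Bs; rewrite /act (dl_sum dld) => [|k]; last first.
  by apply: sm_sum => d; apply: sm_mul.
rewrite -big_split; apply: eq_bigr => k _.
rewrite (dl_sum dld) => [|d]; last by apply: sm_mul.
rewrite -big_split; apply: eq_bigr => d _ /=.
by rewrite (dl_mul dld)// mxE.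
Qed.

Lemma dl_prod (I : eqType) (r : seq I) (F : I -> T -> R) :
  uniq r -> (forall i, sm (F i)) ->
  dl (fun y => \prod_(i <- r) F i y) =
  \sum_(k <- r) dl (F k) * \prod_(i <- r | i != k) F i x.
Proof.
move=> + Fs; elim: r => [_|a r IHr /= /andP[ar ur]].
  rewrite big_nil -[RHS](dl_cst dld 1); apply: (dl_ext dld) => y _.
  by rewrite big_nil.
rewrite (dl_ext dld (g := fun y => F a y * \prod_(i <- r) F i y)); last first.
  by move=> y _; rewrite big_cons.
rewrite (dl_mul dld)//; last exact: sm_prod.
rewrite IHr// big_cons big_cons eqxx/=; congr (_ * _ + _).
  rewrite big_seq_cond [RHS]big_seq_cond; apply: eq_bigl => i.
  by rewrite andbT; case ir : (i \in r) => //=; apply/esym; apply: contraNneq ar => <-.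
rewrite mulr_sumr !big_seq; apply: eq_bigr => k kr.
rewrite big_cons; case: eqP => [ak|_]; first by rewrite ak kr in ar.
by rewrite mulrCA.
Qed.

(** Jacobi's formula, from the Leibniz expansion of the determinant. *)
Lemma dl_det n (B : T -> 'M[R]_n) : smM B ->
  dl (fun y => \det (B y)) = \tr (dlM dl B *m \adj (B x)).
Proof.
move=> Bs; rewrite /determinant (dl_sum dld) => [|s]; last first.
  by apply: sm_mul; [exact: sm_cst|apply: sm_prod].
rewrite /mxtrace.
(* The product rule differentiates one row at a time; expanding the k-th determinant along its
   differentiated row brings in the cofactors of [B x]. *)
transitivity (\sum_(k < n)
    \det (\matrix_(i, j) if i == k then dlM dl B i j else B x i j)).
  rewrite /determinant exchange_big; apply: eq_bigr => s _ /=.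
  rewrite (dl_scale dld) => [|]; last by apply: sm_prod.
  rewrite -mulr_sumr; congr (_ * _).
  rewrite (dl_prod _ _ (F := fun i y => B y i (s i)))//; last exact: index_enum_uniq.
  apply: eq_bigr => k _; rewrite [RHS](bigD1 k)//= !mxE eqxx; congr (_ * _).
  by apply: eq_bigr => i /negbTE ik; rewrite mxE ik.
apply: eq_bigr => k _; rewrite (expand_det_row _ k) mxE.
apply: eq_bigr => j _; rewrite !mxE eqxx; congr (_ * _).
rewrite /cofactor; congr (_ * \det _); apply/matrixP => a b; rewrite !mxE.
by rewrite eq_sym (negbTE (neq_lift _ _)).
Qed.

End At.
End MatrixDerivation.

(** * Covariant differentiation and Killing fields *)

Section MatrixEntries.
Variables (R : comNzRingType) (m n : nat) (i : 'I_m) (j : 'I_n).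
Implicit Types B C : 'M[R]_(m, n).

Lemma add_mxE B C : (B + C) i j = B i j + C i j. Proof. by rewrite mxE. Qed.

Lemma opp_mxE B : (- B) i j = - B i j. Proof. by rewrite mxE. Qed.

Lemma scale_mxE a B : (a *: B) i j = a * B i j. Proof. by rewrite mxE. Qed.

End MatrixEntries.

Section Killing.
Variables (R : realType) (D : nat) (T : topologicalType) (c : chart R D T).
Local Notation U := (chart_dom c).
Local Notation sm := (chart_smooth c U).
Variable w : 'I_D -> T -> R.
Hypothesis ws : forall d, sm (w d).

Definition jac (x : T) : 'M[R]_D := \matrix_(b, d) pder c b (w d) x.

(* The Lie derivative along [w] vanishes, see [lie_tensorE]. *)
Definition invariant n (t : n.-tuple 'I_D -> T -> R) :=
  (forall I, sm (t I)) /\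
  (forall x, U x -> forall I,
     along c w (t I) x = - act (jac x) (fun J => t J x) I).

Lemma jac_sm : smM c jac.
Proof.
move=> i j; apply: sm_ext (sm_pd i (ws j)) => y _.
by rewrite mxE.
Qed.

Definition pdM b (B : T -> 'M[R]_D) x := dlM (fun f => pder c b f x) B.
Definition alM (B : T -> 'M[R]_D) x := dlM (fun f => along c w f x) B.

Lemma pdME b B x i j : pdM b B x i j = pder c b (fun y => B y i j) x.
Proof. by rewrite mxE. Qed.

Lemma alME B x i j : alM B x i j = along c w (fun y => B y i j) x.
Proof. by rewrite mxE. Qed.

Lemma jacE x b d : jac x b d = pder c b (w d) x.
Proof. by rewrite mxE. Qed.

Lemma pdM_sm b (B : T -> 'M[R]_D) : smM c B -> smM c (pdM b B).
Proof.
move=> Bs i j; apply: sm_ext (sm_pd b (Bs i j)) => y _.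
by rewrite mxE.
Qed.

Lemma pdMC b d (B : T -> 'M[R]_D) x : U x -> smM c B ->
  pdM b (pdM d B) x = pdM d (pdM b B) x.
Proof.
move=> Ux Bs; apply/matrixP => i j; rewrite !pdME.
rewrite (pd_ext b (g := pder c d (fun y => B y i j)))//; last first.
  by move=> y _; rewrite pdME.
rewrite pdC//; apply: pd_ext => // y _.
by rewrite pdME.
Qed.

Lemma pdM_jacC b d e x : U x -> pdM b jac x d e = pdM d jac x b e.
Proof.
move=> Ux; rewrite !pdME.
rewrite (pd_ext b (g := pder c d (w e)))//; last by move=> y _; rewrite jacE.
by rewrite pdC//; apply: pd_ext => // y _; rewrite jacE.
Qed.

Lemma alM_pdM b (B : T -> 'M[R]_D) x : U x -> smM c B ->
  alM (pdM b B) x = pdM b (alM B) x - \sum_(d < D) jac x b d *: pdM d B x.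
Proof.
move=> Ux Bs; apply/matrixP => i j; rewrite !mxE summxE.
transitivity (along c w (pder c b (fun y => B y i j)) x).
  by apply: (dl_ext (derivation_along w Ux)) => y _; rewrite mxE.
rewrite along_pd//; congr (_ - _).
  by apply: pd_ext => // y _; rewrite mxE.
by apply: eq_bigr => d _; rewrite !mxE.
Qed.

(** * Covariant derivative and curvature of an invariant connection *)

Section Nabla.
Variable Gam : 'I_D -> T -> 'M[R]_D.
Hypothesis Gams : forall b, smM c (Gam b).
(** The entry (e, a) of [Gam b x] stands for Gamma^a_{be}. The hypothesis says that the flow of [w]
    preserves the connection: it is the tensorial law except for the last term, the second
    derivatives of [w]. *)
Hypothesis GamL : forall x, U x -> forall b,
  alM (Gam b) x = Gam b x *m jac x - jac x *m Gam b x
    - \sum_(d < D) jac x b d *: Gam d x - pdM b jac x.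

(** Differentiating [act (jac x) t] leaves a term in the derivative of [jac], which the
    inhomogeneous term of [GamL] cancels. The commutator of [Gam] and [jac] in [GamL] accounts,
    through [act_comm], for exchanging the two actions. *)
Lemma invariant_nabla n (t : n.-tuple 'I_D -> T -> R) : invariant t ->
  invariant (fun (I : n.+1.-tuple 'I_D) y =>
    pder c (thead I) (t [tuple of behead I]) y -
    act (Gam (thead I) y) (fun J => t J y) [tuple of behead I]).
Proof.
move=> [ts tL]; have acts b J : sm (fun y => act (Gam b y) (fun J => t J y) J).
  by apply: sm_sum => k; apply: sm_sum => d; apply: sm_mul => //; apply: Gams.
split=> [I|x Ux I].
  by apply: sm_add; [exact: sm_pd|apply: sm_opp].
have eI : I = [tuple of thead I :: [tuple of behead I]].
  by case/tupleP: I => i J; apply: val_inj.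
set i := thead I in eI *; set J := [tuple of behead I] in eI *.
have dV := derivation_along w Ux.
rewrite (dl_sub dV) ?(dl_act dV)//; last exact: sm_pd.
rewrite along_pd// -/(alM (Gam i) x) GamL//.
have -> : pder c i (along c w (t J)) x =
    - (act (jac x) (fun K => pder c i (t K) x) J + act (pdM i jac x) (fun K => t K x) J).
  rewrite -(dl_act (derivation_pd i Ux))//; last exact: jac_sm.
  rewrite -(dl_opp (derivation_pd i Ux)); last first.
    by apply: sm_sum => k; apply: sm_sum => d; apply: sm_mul => //; apply: jac_sm.
  by apply: pd_ext => // y /[!inE] Uy; rewrite tL.
have -> : act (Gam i x) (fun K => along c w (t K) x) J =
    - act (Gam i x) (act (jac x) (fun K => t K x)) J.
  by rewrite -act_oppr; apply: eq_act => K; rewrite tL.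
rewrite [in RHS]eI act_cons.
have beheadE (d : 'I_D) (K : n.-tuple 'I_D) :
    [tuple of behead [tuple of d :: K]] = K by apply: val_inj.
under [in RHS]eq_bigr => d _ do rewrite beheadE theadE.
have -> : act (jac x) (fun K : n.-tuple 'I_D =>
     pder c (thead [tuple of i :: K]) (t [tuple of behead [tuple of i :: K]]) x -
     act (Gam (thead [tuple of i :: K]) x) (fun L => t L x)
        [tuple of behead [tuple of i :: K]]) J =
   act (jac x) (fun K => pder c i (t K) x) J
   - act (jac x) (act (Gam i x) (fun K => t K x)) J.
  rewrite -act_oppr -act_addr; apply: eq_act => K.
  by rewrite !beheadE theadE.
have comm := act_comm (Gam i x) (jac x) (fun K => t K x) J.
rewrite act_addl act_addl -comm !act_oppl act_suml.
under [\sum_(j < D) act _ _ _]eq_bigr => d _ do rewrite act_scalel.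
have -> : \sum_(d < D) (pder c d (t J) x -
     act (Gam d x) (fun L => t L x) J) * jac x i d =
   \sum_(d < D) pder c i (w d) x * pder c d (t J) x -
   \sum_(d < D) jac x i d * act (Gam d x) (fun K => t K x) J.
  rewrite -sumrB; apply: eq_bigr => d _.
  by rewrite mulrC mulrBr jacE.
ring.
Qed.

(** The entry (b, h) is R^h_{bef}. The lower index labels the rows of [Gam], which is why the
    products stand in the order opposite to the usual one. *)
Definition curvature e f x : 'M[R]_D :=
  pdM e (Gam f) x - pdM f (Gam e) x + Gam f x *m Gam e x - Gam e x *m Gam f x.

Lemma curvature_sm e f : smM c (curvature e f).
Proof.
apply: smM_add; last by apply: smM_opp; apply: smM_mul.
apply: smM_add; last exact: smM_mul.
by apply: smM_add; [|apply: smM_opp]; apply: pdM_sm.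
Qed.

(** The non-tensorial terms carry second and third derivatives of [w]. The third derivatives are
    symmetric in [e] and [f] and cancel in the antisymmetrization; the second ones cancel partly in
    the same way, partly against those of the quadratic terms. *)
Lemma curvature_along e f x : U x ->
  alM (curvature e f) x = curvature e f x *m jac x - jac x *m curvature e f x
   - \sum_(d < D) jac x e d *: curvature d f x
   - \sum_(d < D) jac x f d *: curvature e d x.
Proof.
move=> Ux; have dV := derivation_along w Ux.
have s1 a b : smM c (pdM a (Gam b)) by apply: pdM_sm.
have s2 a b : smM c (fun y => Gam a y *m Gam b y) by apply: smM_mul.
have n1 := smM_opp (s1 f e); have n2 := smM_opp (s2 e f).
have p1 := smM_add (s1 e f) n1; have p2 := smM_add p1 (s2 f e).
rewrite /alM (dlM_add dV p2 n2) (dlM_add dV p1 (s2 f e)) (dlM_add dV (s1 e f) n1).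
rewrite (dlM_opp dV (s1 f e)) (dlM_opp dV (s2 e f)).
rewrite (dlM_mul dV (Gams f) (Gams e)) (dlM_mul dV (Gams e) (Gams f)).
rewrite -!/(alM _ _) !alM_pdM// !GamL//.
(* This is [GamL], valid on the whole chart, differentiated in direction [a]. *)
have dP a b : pdM a (alM (Gam b)) x =
   pdM a (Gam b) x *m jac x + Gam b x *m pdM a jac x
   - (pdM a jac x *m Gam b x + jac x *m pdM a (Gam b) x)
   - \sum_(d < D) (pdM a jac x b d *: Gam d x + jac x b d *: pdM a (Gam d) x)
   - pdM a (pdM b jac) x.
  have da := derivation_pd a Ux.
  have js := jac_sm; have pjs k : smM c (pdM k jac) by apply: pdM_sm.
  have m1 : smM c (fun y => Gam b y *m jac y) by apply: smM_mul.
  have m2 : smM c (fun y => jac y *m Gam b y) by apply: smM_mul.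
  have m3 d : smM c (fun y => jac y b d *: Gam d y).
    move=> i j; apply: sm_ext (sm_mul (js b d) (@Gams d i j)) => y _.
    by rewrite scale_mxE.
  have m4 : smM c (fun y => \sum_(d < D) jac y b d *: Gam d y).
    move=> i j; apply: sm_ext (sm_sum _ _ (fun d => m3 d i j)) => y _.
    by rewrite summxE.
  have n3 := smM_opp m2; have n4 := smM_opp m4; have n5 := smM_opp (pjs b).
  have q1 := smM_add m1 n3; have q2 := smM_add q1 n4.
  transitivity (dlM (fun f => pder c a f x) (fun y => Gam b y *m jac y - jac y *m Gam b y
    - \sum_(d < D) jac y b d *: Gam d y - pdM b jac y)).
    by apply: (dlM_ext da) => y /[!inE] Uy; rewrite GamL.
  rewrite (dlM_add da q2 n5) (dlM_add da q1 n4) (dlM_add da m1 n3).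
  rewrite (dlM_opp da m2) (dlM_opp da m4) (dlM_opp da (pjs b)).
  rewrite (dlM_mul da (Gams b) js) (dlM_mul da js (Gams b)); congr (_ - _ - _).
  apply/matrixP => i j; rewrite -/(pdM a _ x) pdME summxE.
  transitivity (pder c a (fun y => \sum_(d < D) jac y b d * Gam d y i j) x).
    by apply: pd_ext => // y _; rewrite summxE; apply: eq_bigr => d _; rewrite scale_mxE.
  rewrite (dl_sum da) => [|d]; last by apply: sm_mul => //; apply: Gams.
  apply: eq_bigr => d _; rewrite add_mxE !scale_mxE !pdME (dl_mul da)//; exact: Gams.
rewrite !dP (pdMC f e)//; last exact: jac_sm.
rewrite /curvature.
have sE (F1 F2 F3 F4 : 'I_D -> 'M[R]_D) (a : 'I_D -> R) :
  \sum_(d < D) a d *: (F1 d - F2 d + F3 d - F4 d) =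
  \sum_(d < D) a d *: F1 d - \sum_(d < D) a d *: F2 d
  + \sum_(d < D) a d *: F3 d - \sum_(d < D) a d *: F4 d.
  rewrite -!sumrB -big_split -sumrB; apply: eq_bigr => d _ /=.
  by rewrite scalerBr scalerDr scalerBr.
rewrite !sE.
(* Symmetry of the second derivatives of [w] puts this sum in the form in which its first part meets
   the corresponding sum with [e] and [f] exchanged. *)
have symH : \sum_(d < D) (pdM e jac x f d *: Gam d x + jac x f d *: pdM e (Gam d) x) =
   \sum_(d < D) pdM f jac x e d *: Gam d x + \sum_(d < D) jac x f d *: pdM e (Gam d) x.
  by rewrite big_split; congr (_ + _); apply: eq_bigr => d _; rewrite pdM_jacC.
rewrite symH big_split/=.
have mS (B : 'M[R]_D) (a : 'I_D -> R) : (\sum_(d < D) a d *: Gam d x) *m B =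
   \sum_(d < D) a d *: (Gam d x *m B).
  by rewrite mulmx_suml; apply: eq_bigr => d _; rewrite scalemxAl.
have mS' (B : 'M[R]_D) (a : 'I_D -> R) : B *m (\sum_(d < D) a d *: Gam d x) =
   \sum_(d < D) a d *: (B *m Gam d x).
  by rewrite mulmx_sumr; apply: eq_bigr => d _; rewrite scalemxAr.
rewrite !(mulmxDl, mulmxDr, mulmxBl, mulmxBr, mulNmx, mulmxN, mulmxA, mS, mS').
apply/matrixP => i j; rewrite !(add_mxE, opp_mxE).
ring.
Qed.

End Nabla.

(** * The Levi-Civita connection of an invariant metric is invariant *)

Section Metric.
Variable g : 2.-tuple 'I_D -> T -> R.
Hypothesis ginvt : invariant g.
Let G (x : T) : 'M[R]_D := \matrix_(a, b) g [tuple a; b] x.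
Hypothesis Gsym : forall x, U x -> (G x)^T = G x.
Hypothesis Gunit : forall x, U x -> G x \in unitmx.

Lemma G_sm : smM c G.
Proof.
move=> a b; apply: sm_ext (ginvt.1 [tuple a; b]) => y _.
by rewrite mxE.
Qed.

Lemma G_along x : U x -> alM G x = - (jac x *m G x + G x *m (jac x)^T).
Proof.
move=> Ux; apply/matrixP => a b; rewrite !mxE.
transitivity (along c w (g [tuple a; b]) x).
  by apply: (dl_ext (derivation_along w Ux)) => y _; rewrite mxE.
rewrite ginvt.2// act2 -big_split; congr (- _); apply: eq_bigr => d _ /=.
by rewrite !mxE mulrC.
Qed.

Let Gi x := invmx (G x).

Lemma Gi_sm : smM c Gi.
Proof. exact: smM_inv Gunit G_sm. Qed.

Lemma Gi_along x : U x -> alM Gi x = Gi x *m jac x + (jac x)^T *m Gi x.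
Proof.
move=> Ux; rewrite /alM /Gi (dlM_inv (derivation_along w Ux))//; last exact: G_sm.
rewrite -/(alM G x) G_along// mulmxN mulNmx opprK mulmxDr mulmxDl.
by rewrite !mulmxA mulVmx ?Gunit// mul1mx -!mulmxA mulmxV ?Gunit// mulmx1.
Qed.

Lemma gC a b x : U x -> g [tuple a; b] x = g [tuple b; a] x.
Proof.
by move=> Ux; have /matrixP/(_ b a) := Gsym Ux; rewrite !mxE.
Qed.

Lemma Gi_tr x : U x -> (Gi x)^T = Gi x.
Proof. by move=> Ux; rewrite trmx_inv Gsym. Qed.

Lemma pd_gC d a b x : U x -> pder c d (g [tuple a; b]) x = pder c d (g [tuple b; a]) x.
Proof. by move=> Ux; apply: pd_ext => // y /[!inE]; exact: gC. Qed.

(* [lowered b x e d] is Gamma_{d be}, and [conn b x e a] below Gamma^a_{be}. *)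
Definition lowered b x : 'M[R]_D := \matrix_(e, d)
  (2^-1 * (pder c b (g [tuple d; e]) x + pder c e (g [tuple b; d]) x
           - pder c d (g [tuple b; e]) x)).

Lemma loweredE b x e d : lowered b x e d =
  2^-1 * (pder c b (g [tuple d; e]) x + pder c e (g [tuple b; d]) x
           - pder c d (g [tuple b; e]) x).
Proof. by rewrite mxE. Qed.

Lemma lowered_sm b : smM c (lowered b).
Proof.
move=> e d; apply: (@sm_ext _ _ _ _ (fun x => 2^-1 *
  (pder c b (g [tuple d; e]) x + pder c e (g [tuple b; d]) x
           - pder c d (g [tuple b; e]) x))).
  by move=> y _; rewrite mxE.
apply: sm_mul; first exact: sm_cst.
have gs := ginvt.1.
apply: sm_add; last by apply: sm_opp; apply: sm_pd.
by apply: sm_add; apply: sm_pd.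
Qed.

(** Each derivative of the metric yields two terms with second derivatives of [w]. In the
    Christoffel combination four of the six cancel, and the other two coincide and absorb the factor
    1/2. *)
Lemma lowered_along b x : U x ->
  alM (lowered b) x = - (jac x *m lowered b x + lowered b x *m (jac x)^T
   + \sum_(d < D) jac x b d *: lowered d x) - pdM b jac x *m G x.
Proof.
move=> Ux; have dV := derivation_along w Ux.
have gs := ginvt.1; have js := jac_sm.
have Vq k d e : along c w (pder c k (g [tuple d; e])) x =
   - \sum_(l < D) (pder c k (g [tuple l; e]) x * jac x d l
      + g [tuple l; e] x * pdM k jac x d l
      + (pder c k (g [tuple d; l]) x * jac x e l
      + g [tuple d; l] x * pdM k jac x e l)
      + jac x k l * pder c l (g [tuple d; e]) x).
  have dk := derivation_pd k Ux.
  rewrite along_pd// big_split opprD; congr (_ + _); last first.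
    by congr (- _); apply: eq_bigr => l _; rewrite mxE.
  rewrite (pd_ext k (g := fun y => - \sum_(l < D) (g [tuple l; e] y * jac y d l +
     g [tuple d; l] y * jac y e l)))//; last first.
    by move=> y /[!inE] Uy; rewrite ginvt.2// act2.
  have s1 l : sm (fun y => g [tuple l; e] y * jac y d l) by apply: sm_mul.
  have s2 l : sm (fun y => g [tuple d; l] y * jac y e l) by apply: sm_mul.
  rewrite (dl_opp dk); last by apply: sm_sum => l; apply: sm_add.
  congr (- _); rewrite (dl_sum dk) => [|l]; last by apply: sm_add.
  apply: eq_bigr => l _; rewrite (dl_add dk)// !(dl_mul dk)//.
  by rewrite /pdM !mxE.
apply/matrixP => e d; rewrite !mxE summxE.
rewrite -/(alM _ x) ?alME (dl_ext dV (g := fun y => 2^-1 *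
  (pder c b (g [tuple d; e]) y + pder c e (g [tuple b; d]) y
           - pder c d (g [tuple b; e]) y))); last by move=> y _; rewrite mxE.
have ps k l m : sm (pder c k (g [tuple l; m])) by apply: sm_pd.
rewrite (dl_scale dV); last by apply: sm_add; [exact: sm_add|exact: sm_opp].
rewrite (dl_sub dV)//; last exact: sm_add.
rewrite (dl_add dV)// !Vq -!sumrN -!big_split mulr_sumr -sumrN -big_split.
apply: eq_bigr => l _ /=; rewrite !scale_mxE !loweredE [(jac x)^T _ _]mxE [G x _ _]mxE.
rewrite (pdM_jacC e b l Ux) (pdM_jacC d b l Ux) (pdM_jacC d e l Ux).
rewrite (gC d l Ux) (gC b l Ux).
rewrite (pd_gC b d l Ux) (pd_gC d b l Ux) (pd_gC e b l Ux) (pd_gC l d e Ux).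
by field.
Qed.

Let Gam b x := lowered b x *m Gi x.

Lemma Gam_sm b : smM c (Gam b).
Proof. by apply: smM_mul; [exact: lowered_sm|exact: Gi_sm]. Qed.

(** Raising the index with the inverse metric cancels the transposed [jac], which enters
    [lowered_along] and [Gi_along] with opposite signs. *)
Lemma Gam_along b x : U x ->
  alM (Gam b) x = Gam b x *m jac x - jac x *m Gam b x
    - \sum_(d < D) jac x b d *: Gam d x - pdM b jac x.
Proof.
move=> Ux; rewrite /alM (dlM_mul (derivation_along w Ux)); first last.
- exact: Gi_sm.
- exact: lowered_sm.
rewrite -!/(alM _ _) lowered_along// Gi_along//.
rewrite mulmxDr mulmxDl !mulNmx !mulmxDl -[pdM b jac x *m _ *m _]mulmxA.
rewrite mulmxV ?Gunit// mulmx1 mulmx_suml.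
under eq_bigr do rewrite -scalemxAl.
rewrite /Gam !mulmxA.
apply/matrixP => i j; rewrite !(add_mxE, opp_mxE).
ring.
Qed.

End Metric.
End Killing.

(** * Invariance of metric polynomials *)

Section Alternating.
Variables (R : numDomainType) (D : nat).

Definition alternating (f : D.-tuple 'I_D -> R) := forall (s : 'S_D) I,
  f [tuple tnth I (s j) | j < D] = (-1) ^+ s * f I.

Lemma alternating_repeat f (I : D.-tuple 'I_D) j k :
  alternating f -> j != k -> tnth I j = tnth I k -> f I = 0.
Proof.
move=> fa jk Ijk; have := fa (tperm j k) I.
have -> : [tuple tnth I (tperm j k l) | l < D] = I.
  apply: eq_from_tnth => l; rewrite tnth_mktuple.
  by case: tpermP => // ->.
rewrite odd_tperm jk expr1 mulN1r => /eqP.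
by rewrite -addr_eq0 -mulr2n mulrn_eq0/= => /eqP.
Qed.

(** With as many indices as dimensions, a multi-index either is a permutation of [ord_tuple D] or
    has a repeated entry. *)
Lemma alternating_eq0 f : alternating f -> f (ord_tuple D) = 0 -> forall I, f I = 0.
Proof.
move=> fa f0 I; have [/injectiveP Iinj|] := boolP (injectiveb (tnth I)).
  have -> : I = [tuple tnth (ord_tuple D) (perm Iinj j) | j < D].
    by apply: eq_from_tnth => j; rewrite tnth_mktuple tnth_ord_tuple permE.
  by rewrite fa f0 mulr0.
move=> /injectivePn[j [k jk Ijk]].
exact: alternating_repeat fa jk Ijk.
Qed.

End Alternating.

Section Invariance.
Variables (R : realType) (D : nat) (M : manifold R D).
Variables (g : components M 2) (xi : vcomponents M).
Hypotheses (hg : lorentzian g) (hxi : killing g xi).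

Lemma lie_tensorE (v : vcomponents M) n (t : components M n) c I x :
  lie_tensor v t c I x =
  along c (v c) (t c I) x + act (jac c (v c) x) (fun J => t c J x) I.
Proof.
congr (_ + _); first by apply: eq_bigr => d _; rewrite pderE.
by apply: eq_bigr => k _; apply: eq_bigr => d _; rewrite mxE pderE.
Qed.

Lemma metric_unit c x : atlas c -> chart_dom c x -> metric_mx g c x \in unitmx.
Proof.
move=> cA Ux; have [_ _ /(_ c cA x Ux)[P Pu]] := hg => PG.
have : \det (minkowski R D) != 0.
  rewrite det_diag; apply/prodf_neq0 => i _; rewrite mxE.
  by case: ifP => _; rewrite ?oppr_eq0 oner_eq0.
rewrite -PG !det_mulmx => /[!mulf_eq0] /[!negb_or] /andP[/andP[_ +] _].
by rewrite unitmxE unitfE.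
Qed.

Lemma metric_sym c x : atlas c -> chart_dom c x ->
  (metric_mx g c x)^T = metric_mx g c x.
Proof. by move=> cA Ux; have [_ + _] := hg; apply. Qed.

Section InChart.
Variables (c : chart R D M) (cA : atlas c).
Local Notation U := (chart_dom c).
Local Notation sm := (chart_smooth c U).
Local Notation A := (jac c (xi c)).
Local Notation inv := (invariant c (xi c)).

Lemma killing_sm d : sm (xi c d).
Proof. by have [[+ _] _] := hxi; exact. Qed.
Local Notation ws := killing_sm.

Lemma metric_invariant : inv (g c).
Proof.
split=> [I|x Ux I]; first by have [[+ _] _ _] := hg; exact.
have [_ /(_ c cA x Ux I)] := hxi; rewrite lie_tensorE => /eqP.
by rewrite addr_eq0 => /eqP.
Qed.

Local Notation G := (metric_mx g c).
Let Gsym x : U x -> (G x)^T = G x. Proof. exact: metric_sym. Qed.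
Let Gunit x : U x -> G x \in unitmx. Proof. exact: metric_unit. Qed.

Lemma ginv_sm a b : sm (ginv g c a b).
Proof. exact: (Gi_sm metric_invariant Gunit). Qed.

Lemma ginv_along a b x : U x -> along c (xi c) (ginv g c a b) x =
  \sum_(d < D) (ginv g c a d x * A x d b + A x d a * ginv g c d b x).
Proof.
move=> Ux; have := Gi_along metric_invariant Gunit Ux.
move=> /matrixP/(_ a b); rewrite !mxE -big_split => -> /=.
by apply: eq_bigr => d _; rewrite [(A x)^T _ _]mxE.
Qed.

Lemma ginvC a b x : U x -> ginv g c a b x = ginv g c b a x.
Proof.
by move=> Ux; have /matrixP/(_ b a) := Gi_tr Gsym Ux; rewrite mxE.
Qed.

Definition conn b x := lowered c (g c) b x *m invmx (G x).

Lemma christoffelE a b e x : U x -> christoffel g c a b e x = conn b x e a.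
Proof.
move=> Ux; rewrite /christoffel mxE mulr_sumr; apply: eq_bigr => d _.
rewrite loweredE !pderE -[invmx _ _ _]/(ginv g c d a x) (ginvC d a Ux); ring.
Qed.

Let conn_sm b : smM c (conn b).
Proof. exact: Gam_sm metric_invariant Gunit _. Qed.

Let conn_along x : U x -> forall b, alM c (xi c) (conn b) x =
  conn b x *m A x - A x *m conn b x - \sum_(d < D) A x b d *: conn d x
  - pdM c b A x.
Proof.
move=> Ux b; exact: (Gam_along ws metric_invariant Gsym Gunit b Ux).
Qed.

Lemma invariant_ext n (s t : n.-tuple 'I_D -> M -> R) :
  (forall I, {in U, s I =1 t I}) -> inv s -> inv t.
Proof.
move=> st [ss sL]; split=> [I|x Ux I]; first exact: sm_ext (st I) (ss I).
rewrite -(dl_ext (derivation_along (xi c) Ux) (st I)) sL//; congr (- _).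
by apply: eq_act => J; apply: st; rewrite inE.
Qed.

Lemma riemannE (I : 4.-tuple 'I_D) x : U x ->
  riemann g c I x =
  (curvature c conn (idx I 2) (idx I 3) x *m G x) (idx I 1) (idx I 0).
Proof.
move=> Ux; rewrite /riemann mxE; apply: eq_bigr => h _.
rewrite [RHS]mulrC; congr (_ * _); first by rewrite -(Gsym Ux) !mxE.
set a := idx I 0; set b := idx I 1; set e := idx I 2; set f := idx I 3.
have dC k l m : pd c k (christoffel g c h l m) x = pdM c k (conn l) x m h.
  rewrite pdME -pderE; apply: pd_ext => // y /[!inE] Uy.
  exact: christoffelE.
rewrite !dC /curvature !(add_mxE, opp_mxE) big_split/= sumrN addrA.
by rewrite ![(_ *m _) _ _]mxE; congr (_ + _ - _); apply: eq_bigr => k _;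
  rewrite !christoffelE// mulrC.
Qed.

Lemma idx_tuple4 (I : 4.-tuple 'I_D) :
  I = [tuple idx I 0; idx I 1; idx I 2; idx I 3].
Proof.
apply: eq_from_tnth => -[[|[|[|[|//]]]] j4];
  rewrite [RHS](tnth_nth (tnth I (inord 0)))/= /idx; congr (tnth I _);
  by apply: val_inj; rewrite /= inordK.
Qed.

Lemma riemann_invariant : inv (riemann g c).
Proof.
pose r (I : 4.-tuple 'I_D) y :=
  (curvature c conn (idx I 2) (idx I 3) y *m G y) (idx I 1) (idx I 0).
have Gs : smM c G := G_sm metric_invariant.
have Fs e f : smM c (curvature c conn e f) := curvature_sm conn_sm e f.
apply: (@invariant_ext _ r) => [I x /[!inE] Ux|]; first by rewrite riemannE.
split=> [I|x Ux I]; first exact: (smM_mul (Fs _ _) Gs).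
rewrite {2}[I]idx_tuple4 act4.
set a := idx I 0; set b := idx I 1; set e := idx I 2; set f := idx I 3.
have rE i0 i1 i2 i3 : r [tuple i0; i1; i2; i3] x =
    (curvature c conn i2 i3 x *m G x) i1 i0.
  by rewrite /r /idx !(tnth_nth i0) /= !inordK.
under [in RHS]eq_bigr do rewrite !rE.
transitivity (alM c (xi c) (fun y => curvature c conn e f y *m G y) x b a).
  by rewrite alME.
have dV := derivation_along (xi c) Ux.
rewrite /alM (dlM_mul dV)//.
have := G_along metric_invariant Ux; rewrite /alM => ->.
have := curvature_along ws conn_sm conn_along e f Ux; rewrite /alM => ->.
have sG (F : 'I_D -> 'M[R]_D) (k : 'I_D -> R) :
   (\sum_(d < D) k d *: F d) *m G x = \sum_(d < D) k d *: (F d *m G x).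
  by rewrite mulmx_suml; apply: eq_bigr => d _; rewrite scalemxAl.
set F := curvature c conn.
have -> : (F e f x *m A x - A x *m F e f x - \sum_(d < D) A x e d *: F d f x
    - \sum_(d < D) A x f d *: F e d x) *m G x
    + F e f x *m - (A x *m G x + G x *m (A x)^T) =
  - (F e f x *m G x *m (A x)^T + A x *m (F e f x *m G x)
     + \sum_(d < D) A x e d *: (F d f x *m G x)
     + \sum_(d < D) A x f d *: (F e d x *m G x)).
  rewrite !(mulmxDl, mulmxDr, mulNmx, mulmxN, sG, mulmxA).
  by apply/matrixP => i j; rewrite !(add_mxE, opp_mxE); ring.
rewrite opp_mxE !add_mxE !summxE [(_ *m (A x)^T) _ _]mxE [(A x *m _) _ _]mxE.
rewrite -!big_split; congr (- _); apply: eq_bigr => d _ /=.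
rewrite !scale_mxE [(A x)^T d a]mxE -/F; ring.
Qed.

(** The inverse metric varies with the opposite sign, so its change compensates the action on the
    two contracted indices; the action on the free indices, collected in [S], remains. *)
Lemma contract_invariant n (t : components M n.+2) :
  inv (t c) -> inv (contract_tensor g t c).
Proof.
move=> [ts tL]; have gs := ginv_sm.
split=> [I|x Ux I].
  by apply: sm_sum => a; apply: sm_sum => b; apply: sm_mul.
have dV := derivation_along (xi c) Ux.
pose T a b := t c [tuple of a :: b :: I] x.
pose S a b := act (A x) (fun J => t c [tuple of a :: b :: J] x) I.
have TL a b : along c (xi c) (t c [tuple of a :: b :: I]) x =
   - (\sum_(d < D) (T d b * A x a d + T a d * A x b d) + S a b).
  rewrite tL//; congr (- _).
  have e2 (i j : 'I_D) (J : n.-tuple 'I_D) :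
    [tuple of i :: j :: J] = [tuple of i :: [tuple of j :: J]] by apply: val_inj.
  rewrite e2 act_cons act_cons addrA big_split /=; congr (_ + _ + _).
have -> : act (A x) (fun J => contract_tensor g t c J x) I =
   \sum_(a < D) \sum_(b < D) ginv g c a b x * S a b.
  rewrite /act /contract_tensor.
  under eq_bigr => k _ do under eq_bigr => d _ do rewrite mulr_suml.
  under eq_bigr => k _ do rewrite exchange_big.
  rewrite exchange_big; apply: eq_bigr => a _.
  under eq_bigr => k _ do under eq_bigr => d _ do rewrite mulr_suml.
  under eq_bigr => k _ do rewrite exchange_big.
  rewrite exchange_big; apply: eq_bigr => b _.
  rewrite /S mulr_sumr; apply: eq_bigr => k _; rewrite mulr_sumr.
  by apply: eq_bigr => d _; rewrite mulrA.
rewrite /contract_tensor (dl_sum dV) => [|a]; last first.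
  by apply: sm_sum => b; apply: sm_mul.
rewrite -sumrN.
transitivity (\sum_(a < D) \sum_(b < D) (\sum_(d < D)
  ((ginv g c a d x * A x d b) * T a b + (A x d a * ginv g c d b x) * T a b
   - ginv g c a b x * T d b * A x a d - ginv g c a b x * T a d * A x b d)
   - ginv g c a b x * S a b)).
  apply: eq_bigr => a _; rewrite (dl_sum dV) => [|b]; last exact: sm_mul.
  apply: eq_bigr => b _; rewrite (dl_mul dV)// ginv_along// TL -/(T a b).
  rewrite mulrN mulrDr opprD addrA; congr (_ - _).
  rewrite mulr_suml mulr_sumr -sumrB; apply: eq_bigr => d _; ring.
under eq_bigr do rewrite sumrB.
rewrite sumrB -sumrN -[RHS]add0r; congr (_ + _).
under eq_bigr => a _ do under eq_bigr => b _ do rewrite !sumrB big_split.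
under eq_bigr => a _ do rewrite !sumrB big_split.
rewrite !sumrB big_split /=.
set S1 := \sum_(a < D) _; set S2 := \sum_(a < D) _.
set S3 := \sum_(a < D) _; set S4 := \sum_(a < D) _.
(* Up to renaming the summation indices, each variation term of the inverse metric is the term of
   one contracted index. *)
have -> : S1 = S4.
  apply: eq_bigr => a _; rewrite exchange_big; apply: eq_bigr => b _.
  by apply: eq_bigr => d _; rewrite mulrAC.
have -> : S2 = S3.
  rewrite /S2 exchange_big /= /S3 [RHS]exchange_big; apply: eq_bigr => b _.
  rewrite exchange_big; apply: eq_bigr => a _; apply: eq_bigr => d _ /=.
  by rewrite [A x a d * _]mulrC mulrAC.
by rewrite addrK subrr.
Qed.

(** The Lie derivative of [eps] is again alternating, so a single component decides. For that
    component [act] is multiplication by the trace of [jac], to be compared with the logarithmic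
    derivative of the determinant. *)
Lemma volume_invariant (eps : components M D) : volume_tensor g eps -> inv (eps c).
Proof.
move=> [[epss _] epsa epsq]; have es := epss c cA; split=> // x Ux I.
apply/eqP; rewrite -subr_eq0 opprK; apply/eqP.
have dV := derivation_along (xi c) Ux.
move: I; apply: (@alternating_eq0 _ _ (fun I => along c (xi c) (eps c I) x +
    act (A x) (fun J => eps c J x) I)) => [s I|].
  rewrite mulrDr -act_perm; congr (_ + _).
    rewrite -(dl_scale dV)//; apply: (dl_ext dV) => y /[!inE] Uy.
    exact: epsa.
  by rewrite -act_scaler; apply: eq_act => J; exact: epsa.
set e := ord_tuple D; set q := eps c e x.
have Gs : smM c G := G_sm metric_invariant.
have det0 : \det (G x) != 0 by rewrite -unitfE -unitmxE Gunit.
(* Replacing the k-th entry by some [d] other than [k] repeats the index [d], so only the diagonal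
   entries contribute. *)
have actE : act (A x) (fun J => eps c J x) e = \tr (A x) * q.
  rewrite /mxtrace mulr_suml; apply: eq_bigr => k _; rewrite (bigD1 k)//= big1.
    rewrite addr0 tnth_ord_tuple mulrC; congr (_ * eps c _ x).
    apply: eq_from_tnth => j; rewrite tnth_set_idx tnth_ord_tuple.
    by case: eqP.
  move=> d dk.
  rewrite (@alternating_repeat _ _ (fun J => eps c J x) _ k d) ?mul0r//.
  - by move=> s I; exact: epsa.
  - by rewrite eq_sym.
  by rewrite !tnth_set_idx eqxx tnth_ord_tuple (negbTE dk).
(* The fourth power of eps avoids the sign of the determinant. *)
have q2 y : U y -> eps c e y * eps c e y * (eps c e y * eps c e y) =
    \det (G y) * \det (G y).
  by move=> Uy; rewrite -!expr2 epsq// -normrX ger0_norm ?sqr_ge0.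
have q0 : q != 0.
  apply/eqP => q0; have := q2 x Ux; rewrite -/q q0 !mulr0 => /esym/eqP.
  by rewrite mulf_eq0 orbb (negbTE det0).
have dets : sm (fun y => \det (G y)) := sm_det Gs.
have ee : sm (fun y => eps c e y * eps c e y) by apply: sm_mul.
have := dl_ext dV (f := fun y => eps c e y * eps c e y * (eps c e y * eps c e y))
  (g := fun y => \det (G y) * \det (G y)).
rewrite !(dl_mul dV)// (dl_det dV Gs) -/q => H.
have {H} := H (fun y Uy => q2 y (set_mem Uy)).
have := G_along metric_invariant Ux; rewrite /alM => ->.
rewrite mulNmx mulmxDl -!mulmxA mul_mx_adj mul_mx_scalar linearN linearD/= linearZ/=.
rewrite [\tr (_ *m (_ *m _))]mxtrace_mulC -mulmxA mul_adj_mx mul_mx_scalar.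
rewrite linearZ/= mxtrace_tr.
set v := along _ _ _ _; set dt := \det _; set tA := \tr _ => H.
rewrite actE -/tA.
have q4 := q2 x Ux; rewrite -/q -/dt in q4.
(* By Jacobi's formula the determinant has derivative [- 2 * tA * dt], so differentiating eps^4 =
   det^2 gives 4 q^3 v = - 4 tA dt^2, where dt^2 = q^4. *)
have : q ^+ 3 * (v + tA * q) *+ 4 = 0.
  have -> : q ^+ 3 * (v + tA * q) *+ 4 =
    ((v * q + q * v) * (q * q) + q * q * (v * q + q * v)) +
    (q * q * (q * q)) * tA *+ 4 by ring.
  rewrite H q4; ring.
by move/eqP; rewrite mulrn_eq0 mulf_eq0 expf_eq0/= (negbTE q0)/= => /eqP.
Qed.

Lemma metric_polynomial_invariant n (t : components M n) :
  metric_polynomial g t -> inv (t c).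
Proof.
elim=> {n t}.
- exact: metric_invariant.
- exact: riemann_invariant.
- exact: volume_invariant.
- move=> n s t _ [ss sL] _ [ts tL]; split=> [I|x Ux I]; first exact: sm_add.
  rewrite (dl_add (derivation_along (xi c) Ux))// sL// tL// act_addr.
  by rewrite opprD.
- move=> n a t _ [ts tL]; split=> [I|x Ux I].
    by apply: sm_mul; [exact: sm_cst|].
  by rewrite (dl_scale (derivation_along (xi c) Ux))// tL// act_scaler mulrN.
- move=> m n s t _ [ss sL] _ [ts tL]; split=> [I|x Ux I]; first exact: sm_mul.
  rewrite (dl_mul (derivation_along (xi c) Ux))// sL// tL//.
  have := act_mul (A x) (fun J => s c J x) (fun J => t c J x) I.
  by move=> /= ->; rewrite mulNr mulrN opprD.
- move=> n s t _ [ts tL]; split=> [I|x Ux I]; first exact: ts.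
  by rewrite tL// (act_perm (A x) (fun J => t c J x)).
- by move=> n t _; exact: contract_invariant.
move=> n t _ tI; have := invariant_nabla ws conn_sm conn_along tI.
apply: invariant_ext => I x /[!inE] Ux; rewrite /nabla pderE; congr (_ - _).
apply: eq_bigr => k _; apply: eq_bigr => d _.
by rewrite christoffelE// mulrC.
Qed.

End InChart.
End Invariance.

(** * Consequences of the field equation *)

Lemma sum_tuple2 (V : nmodType) (D : nat) (F : 2.-tuple 'I_D -> V) :
  \sum_I F I = \sum_(a < D) \sum_(b < D) F [tuple a; b].
Proof.
rewrite pair_big /= (reindex (fun q : 'I_D * 'I_D => [tuple q.1; q.2])) //=.
exists (fun I : 2.-tuple 'I_D => (tnth I ord0, tnth I ord_max)) => [[a b]|I] _ //=.
apply: eq_from_tnth => -[[|[|//]] j2]; rewrite (tnth_nth (tnth I ord0)) /=;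
  by congr (tnth I _); apply: val_inj.
Qed.

Lemma sum_ord2 (V : nmodType) (F : 'I_2 -> V) : \sum_(i < 2) F i = F 0 + F 1.
Proof.
rewrite !big_ord_recl big_ord0 addr0; congr (_ + F _).
exact: val_inj.
Qed.

(** * Chart independence of Lie derivatives of functions and of the kinetic term *)

Section ChartChange.
Variables (R : realType) (D : nat) (M : manifold R D).
Implicit Types (c : chart R D M) (f : M -> R).

Lemma near_chart_inv c (V : set M) x : chart_dom c x -> open V -> V x ->
  \forall z \near c x, chart_dom c (chart_inv c z) /\ V (chart_inv c z).
Proof.
move=> Ux oV Vx; have Wx : (c @` chart_dom c) (c x) by exists x.
have := chart_inv_cont Wx; rewrite /prop_for /continuous_at chart_funK// => inv_c.
apply: filterI.
  by apply: inv_c; apply: open_nbhs_nbhs; split=> //; exact: chart_dom_open.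
by apply: inv_c; exact: open_nbhs_nbhs.
Qed.

(** Near [c x] the expression of [f] in [c] is its expression in [c'] composed with the transition
    map; the two need agree only on the overlap of the domains. *)
Lemma pd_change c c' f x i : atlas c -> atlas c' ->
  chart_dom c x -> chart_dom c' x -> chart_Ck c' (chart_dom c') 1 f ->
  pd c i f x = \sum_(j < D) pd c i (coord c' j) x * pd c' j f x.
Proof.
move=> cA c'A Ux U'x fC.
have W'x : (c' @` chart_dom c') (c' x) by exists x.
have [cd cE] : is_derive (c x) (delta_mx 0 i : 'rV[R]_D)
    ((f \o chart_inv c') \o (c' \o chart_inv c))
    (\sum_(j < D) 'D_(delta_mx 0 i) (fun z => (c' \o chart_inv c) z 0 j) (c x) *
      partial j (f \o chart_inv c') ((c' \o chart_inv c) (c x))).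
  apply: (chain_rule (@chart_cod_open _ _ _ c') _ fC) => [|j].
    by rewrite /= chart_funK.
  have Cx : (c @` (chart_dom c `&` chart_dom c')) (c x) by exists x.
  have wC : Ck 1 (c @` (chart_dom c `&` chart_dom c')) (coord c' j \o chart_inv c) :=
    atlas_compat cA c'A j 1%N.
  exact: Ck_derivable wC Cx.
have -> : pd c i f x = 'D_(delta_mx 0 i)
    ((f \o chart_inv c') \o (c' \o chart_inv c)) (c x).
  apply: near_eq_derive.
  have := near_chart_inv Ux (@chart_dom_open _ _ _ c') U'x.
  by apply: filterS => z [_ U'z] /=; rewrite chart_funK.
by rewrite cE; apply: eq_bigr => j _; rewrite /= chart_funK.
Qed.

(** The definition uses [chart_at x], which varies with the point in an uncontrolled way. To
    differentiate [lie v f] once more it must be expressed in one chart on a whole neighbourhood. *)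
Lemma lieE (v : vcomponents M) f c x : vector_field v -> class_C 1 f ->
  atlas c -> chart_dom c x -> lie v f x = along c (v c) f x.
Proof.
move=> [_ vt] fC cA Ux; rewrite /lie.
set c' := chart_at x; have c'A : atlas c' := chart_at_atlas x.
have U'x : chart_dom c' x := chart_at_dom x.
rewrite /along; under [RHS]eq_bigr => d _ do
  rewrite pderE (pd_change d cA c'A Ux U'x (fC _ c'A)) mulr_sumr.
rewrite exchange_big; apply: eq_bigr => j _ /=.
rewrite (vt c c' cA c'A x Ux U'x) mulr_suml; apply: eq_bigr => d _; ring.
Qed.

Variables (g : components M 2) (hg : lorentzian g) (phi : M -> R).

Definition grad c x : 'cV[R]_D := \col_a pder c a phi x.

Lemma kinetic_mxE c x :
  - 2^-1 * (\sum_(a < D) \sum_(b < D) ginv g c a b x * pd c a phi x * pd c b phi x)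
  = - 2^-1 * ((grad c x)^T *m invmx (metric_mx g c x) *m grad c x) 0 0.
Proof.
congr (_ * _); rewrite mxE exchange_big; apply: eq_bigr => b _ /=.
rewrite mxE mulr_suml [(grad c x) _ _]mxE pderE; apply: eq_bigr => a _ /=.
by rewrite !mxE pderE [pd c a phi x * _]mulrC.
Qed.

(** The gradient is multiplied by the Jacobian [J] and the inverse metric by the inverses of [J] and
    its transpose, so all factors cancel. *)
Lemma kineticE c x : smooth phi -> atlas c -> chart_dom c x ->
  kinetic g phi x =
  - 2^-1 * ((grad c x)^T *m invmx (metric_mx g c x) *m grad c x) 0 0.
Proof.
move=> phis cA Ux; rewrite /kinetic.
set c' := chart_at x; have c'A : atlas c' := chart_at_atlas x.
have U'x : chart_dom c' x := chart_at_dom x.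
rewrite kinetic_mxE; congr (_ * _).
pose J : 'M[R]_D := \matrix_(i, k) pd c i (coord c' k) x.
have uE : grad c x = J *m grad c' x.
  apply/colP => i; rewrite !mxE pderE (pd_change i cA c'A Ux U'x (phis 1%N _ c'A)).
  by apply: eq_bigr => j _; rewrite !mxE pderE.
have GE : metric_mx g c x = J *m metric_mx g c' x *m J^T.
  apply/matrixP => a b; have [[_ gt] _ _] := hg.
  rewrite mxE (gt c' c c'A cA x U'x Ux) sum_tuple2 exchange_big mxE.
  apply: eq_bigr => l _; rewrite mxE mulr_suml; apply: eq_bigr => k _ /=.
  by rewrite !big_ord_recl big_ord0 !(tnth_nth k)/= !mxE mulr1; ring.
have Gu := metric_unit hg cA Ux.
have G'u := metric_unit hg c'A U'x.
(* Invertibility of the Jacobian is read off from the congruence [GE], whose left side is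
   invertible. *)
have Ju : J \in unitmx.
  by move: Gu; rewrite GE !unitmx_mul => /andP[/andP[]].
have JTu : J^T \in unitmx by rewrite unitmx_tr.
have GiE : invmx (metric_mx g c x) =
    invmx J^T *m invmx (metric_mx g c' x) *m invmx J.
  rewrite -[RHS]mulmx1 -(mulmxV Gu) GE !mulmxA.
  by rewrite mulmxKV// mulmxKV// mulVmx// mul1mx.
rewrite GiE uE trmx_mul !mulmxA mulmxKV// mulmxK//.
Qed.

End ChartChange.

(** * The Lie derivative of the field equation and its contractions *)

Section LocalIdentities.
Variables (R : realType) (D : nat) (M : manifold R D).
Variables (g : components M 2) (hg : lorentzian g).
Variables (phi : M -> R) (phis : smooth phi).
Variables (xi : vcomponents M) (hxi : killing g xi).
Local Notation X := (kinetic g phi).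
Local Notation L := (lie xi phi).

Let xiv : vector_field xi. Proof. by case: hxi. Qed.

Lemma pderivable_phiX c (U : set 'rV[R]_2) (q : 'rV[R]_2 -> R) x :
  atlas c -> chart_dom c x -> open U -> U (phiX g phi x) -> Ck 1 U q ->
  pderivable c phi x -> pderivable c X x ->
  pderivable c (q \o phiX g phi) x /\
  forall i, pder c i (q \o phiX g phi) x =
    pder c i phi x * partial 0 q (phiX g phi x) +
    pder c i X x * partial 1 q (phiX g phi x).
Proof.
move=> cA Ux oU Uq qC dphi dX.
have wE (h : M -> 'rV[R]_2) (j : 'I_2) (k : M -> R) : (fun y => h y 0 j) = k ->
    (fun z => (h \o chart_inv c) z 0 j) = k \o chart_inv c.
  by move=> <-.
have E0 : (fun y => phiX g phi y 0 0) = phi by apply/funext => y; rewrite mxE.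
have E1 : (fun y => phiX g phi y 0 1) = X by apply/funext => y; rewrite mxE.
have key i := @chain_rule R 'rV[R]_D 2 U q (phiX g phi \o chart_inv c) (c x)
  (delta_mx 0 i).
have Uq' : U ((phiX g phi \o chart_inv c) (c x)) by rewrite /= chart_funK.
have dw i j : derivable (fun z => (phiX g phi \o chart_inv c) z 0 j) (c x)
    (delta_mx 0 i).
  have [->|->] : j = 0 \/ j = 1.
    by case: j => -[|[|//]] jj; [left|right]; apply: val_inj.
  - by rewrite (wE _ _ _ E0); exact: dphi.
  by rewrite (wE _ _ _ E1); exact: dX.
split=> i; have [dq qE] := key i oU Uq' qC (dw i); first exact: dq.
have w0 : 'D_(delta_mx 0 i) (fun z => (phiX g phi \o chart_inv c) z 0 0) (c x) =
    pd c i phi x by rewrite (wE _ _ _ E0).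
have w1 : 'D_(delta_mx 0 i) (fun z => (phiX g phi \o chart_inv c) z 0 1) (c x) =
    pd c i X x by rewrite (wE _ _ _ E1).
have xE : (phiX g phi \o chart_inv c) (c x) = phiX g phi x.
  by rewrite /= chart_funK.
rewrite !pderE; apply: (etrans qE); apply: (etrans (sum_ord2 _)).
rewrite xE; congr (_ * _ + _ * _); [exact: w0|exact: w1].
Qed.

Section InChart.
Variables (c : chart R D M) (cA : atlas c).
Local Notation U := (chart_dom c).
Local Notation sm := (chart_smooth c U).
Local Notation A := (jac c (xi c)).
Local Notation V := (along c (xi c)).
Local Notation G := (metric_mx g c).
Local Notation Gi := (fun y => invmx (metric_mx g c y)).
Local Notation u := (grad phi c).

Let phi_sm : sm phi. Proof. by move=> k; apply: phis. Qed.
Let ws := killing_sm hxi cA.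
Let gI := metric_invariant hg hxi cA.
Let Gsym x (Ux : U x) := metric_sym hg cA Ux.
Let Gunit x (Ux : U x) := metric_unit hg cA Ux.
Let Gis : smM c Gi := Gi_sm gI Gunit.

Lemma lie_phiE : {in U, L =1 V phi}.
Proof. by move=> y /[!inE] Uy; rewrite (lieE xiv (phis 1%N) cA Uy). Qed.

Lemma lie_phi_sm : sm L.
Proof.
apply: (@sm_ext _ _ _ _ (V phi)) => [y Uy|]; first by rewrite lie_phiE.
exact: sm_along.
Qed.

Lemma grad_sm : smM c u.
Proof.
move=> a j; apply: sm_ext (sm_pd a phi_sm) => y _.
by rewrite mxE.
Qed.

Lemma kinetic_sm : sm X.
Proof.
have us : smM c (fun y => (u y)^T).
  by move=> a j; apply: sm_ext (grad_sm j a) => y _; rewrite [RHS]mxE.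
apply: (@sm_ext _ _ _ _ (fun y => - 2^-1 * ((u y)^T *m Gi y *m u y) 0 0)).
  by move=> y /[!inE] Uy; rewrite (kineticE hg phis cA Uy).
apply: sm_mul; first exact: sm_cst.
exact: (smM_mul (smM_mul us Gis) grad_sm).
Qed.

Definition dL y : 'cV[R]_D := \col_a pder c a L y.

Lemma grad_along x : U x ->
  dlM (fun f => V f x) u = dL x - A x *m u x.
Proof.
move=> Ux; apply/colP => a; rewrite !mxE.
have -> : V (fun y => u y a 0) x = V (pder c a phi) x.
  by apply: (dl_ext (derivation_along (xi c) Ux)) => y _; rewrite mxE.
rewrite along_pd//; congr (_ - _).
  by apply: pd_ext => // y Uy; rewrite lie_phiE.
by apply: eq_bigr => d _; rewrite !mxE.
Qed.

(** The [jac] terms from the gradient cancel those from the inverse metric, so differentiating X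
    along a Killing field only replaces one gradient of phi by that of [L]. *)
Lemma kinetic_along x : U x -> V X x = - ((u x)^T *m Gi x *m dL x) 0 0.
Proof.
move=> Ux; have dV := derivation_along (xi c) Ux.
have us : smM c (fun y => (u y)^T).
  by move=> a j; apply: sm_ext (grad_sm j a) => y _; rewrite [RHS]mxE.
have uGs := smM_mul us Gis.
rewrite (dl_ext dV (g := fun y => - 2^-1 * ((u y)^T *m Gi y *m u y) 0 0)); last first.
  by move=> y /[!inE] Uy; rewrite (kineticE hg phis cA Uy).
rewrite (dl_scale dV); last exact: (smM_mul uGs grad_sm).
have -> : V (fun y => ((u y)^T *m Gi y *m u y) 0 0) x =
   dlM (fun f => V f x) (fun y => (u y)^T *m Gi y *m u y) 0 0 by rewrite mxE.
rewrite (dlM_mul dV uGs grad_sm) (dlM_mul dV us Gis) grad_along//.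
have -> : dlM (fun f => V f x) (fun y => (u y)^T) = (dL x - A x *m u x)^T.
  rewrite -grad_along//; apply/matrixP => i j; rewrite !mxE.
  by apply: (dl_ext dV) => y _; rewrite mxE.
have := Gi_along gI Gunit Ux; rewrite /alM => ->.
have sw : (dL x)^T *m Gi x *m u x = (u x)^T *m Gi x *m dL x.
  have /matrixP tr1 : ((u x)^T *m Gi x *m dL x)^T = (dL x)^T *m Gi x *m u x.
    by rewrite !trmx_mul trmxK (Gi_tr Gsym Ux) mulmxA.
  by apply/matrixP => i j; rewrite -tr1 mxE !ord1.
rewrite linearB /= trmx_mul.
rewrite !(mulmxDl, mulmxDr, mulNmx, mulmxN, mulmxBl, mulmxBr, mulmxA) sw.
rewrite !(add_mxE, opp_mxE); by field.
Qed.

(** [derivation_at] asks for smooth factors; this product rule also covers [p] and its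
    derivatives. *)
Lemma along_mul f h x : U x -> pderivable c f x -> pderivable c h x ->
  V (fun y => f y * h y) x = V f x * h x + f x * V h x.
Proof.
move=> Ux fd hd; rewrite /along mulr_suml mulr_sumr -big_split.
by apply: eq_bigr => d _ /=; rewrite pd_mul//; ring.
Qed.

Lemma along_add f h x : pderivable c f x -> pderivable c h x ->
  V (fun y => f y + h y) x = V f x + V h x.
Proof.
move=> fd hd; rewrite /along -big_split.
by apply: eq_bigr => d _ /=; rewrite pd_add//; ring.
Qed.

Variables (p : 'rV[R]_2 -> R) (hp : nonsingular_p g phi p).
Variables (E : components M 2) (hE : metric_polynomial g E).
Hypothesis hfield : field_equation g phi p E.
Hypothesis hD : (2 <= D)%N.
Local Notation pX := (p_X g phi p).
Local Notation pphi := (p_phi g phi p).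
Local Notation P := (p \o phiX g phi).

Lemma p_phi_pderivable x : U x -> pderivable c pphi x.
Proof.
move=> Ux; have [W [oW pC Wx]] := hp.
by apply: (pderivable_phiX cA Ux oW (Wx x) (Ck_partial 0 pC) _ _).1;
  apply: sm_pderivable => //; exact: kinetic_sm.
Qed.

Lemma p_X_pderivable x : U x -> pderivable c pX x.
Proof.
move=> Ux; have [W [oW pC Wx]] := hp.
by apply: (pderivable_phiX cA Ux oW (Wx x) (Ck_partial 1 pC) _ _).1;
  apply: sm_pderivable => //; exact: kinetic_sm.
Qed.

Lemma p_pderivable x : U x -> pderivable c P x.
Proof.
move=> Ux; have [W [oW pC Wx]] := hp.
by apply: (pderivable_phiX cA Ux oW (Wx x) (CkW pC) _ _).1;
  apply: sm_pderivable => //; exact: kinetic_sm.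
Qed.

Lemma p_along x : U x -> V P x = pphi x * L x + pX x * V X x.
Proof.
move=> Ux; have [W [oW pC Wx]] := hp.
have [_ pE] := pderivable_phiX cA Ux oW (Wx x) (CkW pC)
  (sm_pderivable phi_sm Ux) (sm_pderivable kinetic_sm Ux).
rewrite lie_phiE ?inE// /along !mulr_sumr -big_split.
by apply: eq_bigr => d _ /=; rewrite pE /p_phi /p_X; ring.
Qed.

(** [E] is a nonzero constant multiple of the energy-momentum tensor, which is therefore invariant.
    The [jac] terms of the gradients and of the metric cancel those of [act], and what is left is
    the Lie derivative of the tensor in matrix form. *)
Lemma field_mx x : U x ->
  V pX x *: (u x *m (u x)^T) + pX x *: (dL x *m (u x)^T + u x *m (dL x)^T)
  + V P x *: G x = 0.
Proof.
move=> Ux; have dV := derivation_along (xi c) Ux.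
have [Es EL] := metric_polynomial_invariant hg hxi cA hE.
pose T a b y := pX y * (pder c a phi y * pder c b phi y) + P y * g c [tuple a; b] y.
have c0 : (8 * pi : R) != 0 by rewrite mulf_neq0 ?gt_eqF ?pi_gt0.
have ET a b : {in U, E c [tuple a; b] =1 fun y => 8 * pi * T a b y}.
  move=> y /[!inE] Uy; rewrite (hfield cA Uy); congr (_ * _).
  rewrite /energy_momentum /T /idx !(tnth_nth a)/= !inordK// !pderE/=.
  by rewrite mulrA.
have phid a : sm (pder c a phi) by apply: sm_pd.
have pXd := p_X_pderivable Ux; have Pd := p_pderivable Ux.
have sd f : sm f -> pderivable c f x by move=> fs; apply: sm_pderivable.
have F1 a b := sd _ (sm_mul (phid a) (phid b)).
have F2 a b := sd _ (gI.1 [tuple a; b]).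
have F3 a b := pderivable_mul pXd (F1 a b).
have F4 a b := pderivable_mul Pd (F2 a b).
have Ts a b : pderivable c (T a b) x := pderivable_add (F3 a b) (F4 a b).
have TL a b : V (T a b) x = - \sum_(d < D) (T d b x * A x a d + T a d x * A x b d).
  have := EL x Ux [tuple a; b]; rewrite act2.
  rewrite (dl_ext dV (ET a b)) (along_mul Ux (@pderivable_cst _ _ _ c _ x) (Ts a b)).
  rewrite (dl_cst dV).
  rewrite mul0r add0r.
  under eq_bigr => d _ do rewrite !ET ?inE//.
  move=> H; apply: (mulfI c0); rewrite H mulrN mulr_sumr; congr (- _).
  by apply: eq_bigr => d _; ring.
apply/matrixP => a b.
have Vphi k : V (pder c k phi) x = dL x k 0 - \sum_(d < D) A x k d * pder c d phi x.
  rewrite along_pd// [dL x k 0]mxE; congr (_ - _).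
    by apply: pd_ext => // y Uy; rewrite lie_phiE.
  by apply: eq_bigr => d _; rewrite mxE.
have := TL a b; rewrite (along_add (F3 a b) (F4 a b)) (along_mul Ux pXd (F1 a b)).
rewrite (along_mul Ux (sd _ (phid a)) (sd _ (phid b))) (along_mul Ux Pd (F2 a b)).
rewrite gI.2// act2 !Vphi.
have -> : \sum_(d < D) (T d b x * A x a d + T a d x * A x b d) =
   pX x * (pder c b phi x * (\sum_(d < D) A x a d * pder c d phi x)
       + pder c a phi x * (\sum_(d < D) A x b d * pder c d phi x))
   + P x * (\sum_(d < D) (g c [tuple d; b] x * A x a d + g c [tuple a; d] x * A x b d)).
  rewrite mulrDr !mulr_sumr -!big_split; apply: eq_bigr => d _; rewrite /T /=; ring.
set S1 := \sum_(d < D) _; set S2 := \sum_(d < D) _; set S3 := \sum_(d < D) _.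
move=> H.
have mul11 (v w : 'cV[R]_D) : (v *m w^T) a b = v a 0 * w b 0.
  by rewrite mxE big_ord_recl big_ord0 addr0 mxE.
rewrite !(add_mxE, scale_mxE) !mul11 [u x a 0]mxE [u x b 0]mxE [G x a b]mxE [RHS]mxE.
move: H => /eqP; rewrite -subr_eq0 => /eqP <-; ring.
Qed.

Let mul11 (v w : 'M[R]_1) : (v *m w) 0 0 = v 0 0 * w 0 0.
Proof. by rewrite mxE big_ord_recl big_ord0 addr0. Qed.

Let kin_mx x : U x -> ((u x)^T *m Gi x *m u x) 0 0 = - 2 * X x.
Proof. by move=> Ux; rewrite (kineticE hg phis cA Ux); field. Qed.

Let kinL_mx x : U x -> ((u x)^T *m Gi x *m dL x) 0 0 = - V X x.
Proof. by move=> Ux; rewrite kinetic_along// opprK. Qed.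

Let kinL_mx' x : U x -> ((dL x)^T *m Gi x *m u x) 0 0 = - V X x.
Proof.
move=> Ux; rewrite -kinL_mx//.
have -> : (dL x)^T *m Gi x *m u x = ((u x)^T *m Gi x *m dL x)^T.
  by rewrite !trmx_mul trmxK (Gi_tr Gsym Ux) mulmxA.
by rewrite mxE.
Qed.

Lemma field_trace x : U x ->
  - 2 * X x * V pX x - 2 * pX x * V X x + D%:R * V P x = 0.
Proof.
move=> Ux; have := congr1 (fun N => \tr (Gi x *m N)) (field_mx Ux).
have tr1 (v w : 'cV[R]_D) : \tr (Gi x *m (v *m w^T)) = (w^T *m Gi x *m v) 0 0.
  by rewrite mulmxA mxtrace_mulC mulmxA trace_mx11.
rewrite /= mulmx0 mxtrace0 !mulmxDr -!scalemxAr !mulmxDr !mxtraceD !mxtraceZ !mxtraceD.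
rewrite !tr1 mulVmx ?Gunit// mxtrace1 kin_mx// kinL_mx// kinL_mx'// => H.
by rewrite -[RHS]H; ring.
Qed.

Lemma field_double x : U x ->
  V pX x * (- 2 * X x) ^+ 2 + 2 * pX x * (- V X x) * (- 2 * X x)
  + V P x * (- 2 * X x) = 0.
Proof.
move=> Ux.
have := congr1 (fun N => ((u x)^T *m Gi x *m N *m (Gi x *m u x)) 0 0) (field_mx Ux).
have f1 (v w : 'cV[R]_D) : ((u x)^T *m Gi x *m (v *m w^T) *m (Gi x *m u x)) 0 0 =
    ((u x)^T *m Gi x *m v) 0 0 * (w^T *m Gi x *m u x) 0 0.
  by rewrite -mul11 !mulmxA.
have f2 : ((u x)^T *m Gi x *m G x *m (Gi x *m u x)) 0 0 = - 2 * X x.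
  by rewrite mulmxKV ?Gunit// mulmxA kin_mx.
rewrite /= mulmx0 mul0mx [in RHS]mxE.
rewrite !(mulmxDr, mulmxDl, =^~ scalemxAr, =^~ scalemxAl) !(add_mxE, scale_mxE).
rewrite !f1 f2 kin_mx// kinL_mx// kinL_mx'// => H.
by rewrite -[RHS]H; ring.
Qed.

(** X times the trace plus half the double contraction eliminates the derivatives of [pX] and X,
    leaving the factor D - 1, which is invertible since D is at least 2. *)
Lemma kinetic_p_along x : U x -> X x * V P x = 0.
Proof.
move=> Ux; have tr := field_trace Ux; have db := field_double Ux.
have D1 : (D%:R - 1 : R) != 0 by rewrite subr_eq0 gt_eqF// ltr1n.
apply: (mulfI D1); rewrite mulr0.
have -> : (D%:R - 1) * (X x * V P x) =
  X x * (- 2 * X x * V pX x - 2 * pX x * V X x + D%:R * V P x)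
  + 2^-1 * (V pX x * (- 2 * X x) ^+ 2 + 2 * pX x * (- V X x) * (- 2 * X x)
  + V P x * (- 2 * X x)) by field.
by rewrite tr db !mulr0 addr0.
Qed.

Lemma p_along0 x : U x -> V P x = 0.
Proof.
move=> Ux; have D0 : (D%:R : R) != 0 by rewrite pnatr_eq0 -lt0n (leq_trans _ hD).
have dV := derivation_along (xi c) Ux.
have [X0|X0] := eqVneq (X x) 0; last first.
  by have /eqP := kinetic_p_along Ux; rewrite mulf_eq0 (negbTE X0) => /eqP.
have [LX0|LX0] := eqVneq (V X x) 0.
  have := field_trace Ux; rewrite X0 LX0 !mulr0 mul0r subr0 add0r => /eqP.
  by rewrite mulf_eq0 (negbTE D0) => /eqP.
have sd f : sm f -> pderivable c f x by move=> fs; apply: sm_pderivable.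
have VXs : sm (V X) := sm_along ws kinetic_sm.
pose Q y := pphi y * L y + pX y * V X y.
(* [Q] is L_xi p rewritten by [p_along]: in this form it is visibly differentiable, as it involves
   only first derivatives of the C^2 function [p]. *)
have Qd : pderivable c Q x := pderivable_add
  (pderivable_mul (p_phi_pderivable Ux) (sd _ lie_phi_sm))
  (pderivable_mul (p_X_pderivable Ux) (sd _ VXs)).
have XQ : V (fun y => X y * Q y) x = 0.
  rewrite -[RHS](dl_cst dV 0); apply: (dl_ext dV) => y /[!inE] Uy.
  by rewrite /Q -p_along// kinetic_p_along.
move: XQ; rewrite (along_mul Ux (sd _ kinetic_sm) Qd) X0 mul0r addr0 => /eqP.
by rewrite mulf_eq0 (negbTE LX0)/= p_along// => /eqP.
Qed.

Lemma field_lie_p x : U x -> pphi x * L x + pX x * V X x = 0.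
Proof. by move=> Ux; rewrite -p_along// p_along0. Qed.

Lemma field_lie_pX x : U x -> X x * V pX x + pX x * V X x = 0.
Proof.
move=> Ux; have := field_trace Ux; rewrite p_along0// mulr0 addr0 => H.
by apply: (@mulfI _ (- 2)) => //; rewrite mulr0 -[RHS]H; ring.
Qed.

Lemma field_xi x : U x -> V pX x * L x ^+ 2 + 2 * pX x * L x * V L x = 0.
Proof.
move=> Ux; pose v : 'rV[R]_D := \row_d xi c d x.
have vu : (v *m u x) 0 0 = L x.
  rewrite lie_phiE ?inE// mxE; apply: eq_bigr => d _.
  by rewrite !mxE.
have vl : (v *m dL x) 0 0 = V L x.
  by rewrite mxE; apply: eq_bigr => d _; rewrite !mxE.
have trE (w : 'cV[R]_D) : (w^T *m v^T) 0 0 = (v *m w) 0 0.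
  by rewrite -trmx_mul mxE.
have := congr1 (fun N => (v *m N *m v^T) 0 0) (field_mx Ux).
have f1 (a b : 'cV[R]_D) : (v *m (a *m b^T) *m v^T) 0 0 =
    (v *m a) 0 0 * (v *m b) 0 0.
  by rewrite -(trE b) -mul11 !mulmxA.
rewrite /= p_along0// scale0r addr0 mulmx0 mul0mx [in RHS]mxE.
rewrite !(mulmxDr, mulmxDl, =^~ scalemxAr, =^~ scalemxAl) !(add_mxE, scale_mxE).
rewrite !f1 vu vl => H.
by rewrite -[RHS]H; ring.
Qed.

End InChart.
End LocalIdentities.

(** * Orbits *)

Section LinearOde.
Variable R : realType.

Lemma derivable_continuous_at (f : R -> R) t : derivable f t (1 : R) ->
  {for t, continuous f}.
Proof. by move=> /derivable1_diffP/differentiable_continuous. Qed.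

(** As [h] is nonnegative, the bound [h t <= 0] suffices, and it follows from a monotonicity
    argument. [b] may be unbounded on [J], so it is bounded only between [t0] and [t], by
    compactness. *)
Lemma linear_ode_zero (J : set R) (h b : R -> R) (t0 t : R) :
  is_interval J -> (forall s, J s -> {for s, continuous b}) ->
  (forall s, J s -> 0 <= h s) ->
  (forall s, J s -> is_derive s (1 : R) h (b s * h s)) ->
  J t0 -> J t -> h t0 = 0 -> h t = 0.
Proof.
move=> Ji bc h0 hd Jt0 Jt ht0.
have within_cont (f : R -> R) x y : (forall s, x <= s <= y -> {for s, continuous f}) ->
    {within `[x, y], continuous f}.
  by move=> fc; apply/continuous_in_subspaceT => z; rewrite inE /= in_itv; apply: fc.
have bound x y : J x -> J y -> x <= y -> exists K, forall s, x <= s <= y -> `|b s| <= K.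
  move=> Jx Jy xy; have [|z _ zmax] := @EVT_max R (fun s => `|b s|) x y xy.
    apply: within_cont => s xsy.
    apply: (@continuous_comp _ _ _ b (fun r : R => `|r|)); last exact: norm_continuous.
    exact/bc/(Ji x y).
  by exists `|b z| => s sxy; apply: zmax; rewrite in_itv.
(* h exp(K t) is monotone, in the direction of the sign of K, once
   |b| <= |K|. *)
have kd k s : J s -> is_derive s (1 : R) (fun r => h r * expR (k * r))
    ((b s + k) * h s * expR (k * s)).
  move=> /hd hds; apply: is_derive_eq.
  rewrite /GRing.scale/=; ring.
have mvt k x y : J x -> J y -> x <= y -> exists2 s, x <= s <= y &
   h y * expR (k * y) - h x * expR (k * x) =
   (b s + k) * h s * expR (k * s) * (y - x).
  move=> Jx Jy xy.
  have [|||s sI e] := @MVT_segment R (fun r => h r * expR (k * r))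
    (fun s => (b s + k) * h s * expR (k * s)) x y.
  - exact: xy.
  - move=> s /[!in_itv] /andP[xs sy]; apply: kd; apply: (Ji x y) => //.
    by rewrite !ltW.
  - apply: within_cont => s sxy; apply: derivable_continuous_at.
    by have [] := kd k s (Ji x y Jx Jy s sxy).
  by exists s => //; rewrite in_itv in sI.
apply/eqP; rewrite eq_le h0// andbT.
have [tt|tt] := leP t0 t.
  have [K bK] := bound _ _ Jt0 Jt tt.
  have [s sI] := mvt (- K) _ _ Jt0 Jt tt.
  rewrite ht0 mul0r subr0 => e.
  rewrite -(pmulr_lle0 _ (expR_gt0 (- K * t))) e.
  rewrite mulr_le0_ge0 ?subr_ge0//.
  rewrite mulr_le0_ge0 ?expR_ge0//.
  rewrite mulr_le0_ge0 ?h0//; last exact: (Ji t0 t).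
  by rewrite subr_le0 (le_trans (ler_norm _))// bK.
have [K bK] := bound _ _ Jt Jt0 (ltW tt).
have [s sI] := mvt K _ _ Jt Jt0 (ltW tt).
rewrite ht0 mul0r sub0r => e.
rewrite -(pmulr_lle0 _ (expR_gt0 (K * t))) -oppr_ge0 e.
rewrite mulr_ge0 ?subr_ge0 ?(ltW tt)// mulr_ge0 ?expR_ge0//.
rewrite mulr_ge0 ?h0//; last exact: (Ji t t0).
have := bK s sI; rewrite ler_norml => /andP[+ _].
by rewrite -subr_ge0 opprK.
Qed.

End LinearOde.

(** * Differentiation along integral curves *)

Section Curves.
Variables (R : realType) (D : nat) (M : manifold R D) (v : vcomponents M).
Variables (J : set R) (u : R -> M) (uJ : integral_curve v J u).

Lemma integral_curve_chain f t : class_C 1 f -> J t ->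
  is_derive t (1 : R) (f \o u) (lie v f (u t)).
Proof.
move=> fC Jt; have [_ _ /(_ t Jt)[uc ud]] := uJ.
set c := chart_at (u t); have cA : atlas c := chart_at_atlas _.
have Ut : chart_dom c (u t) := chart_at_dom _.
have Wt : (c @` chart_dom c) ((c \o u) t) by exists (u t).
have cd i := ud c cA Ut i.
have dw i : derivable (fun r => (c \o u) r 0 i) t (1 : R) by have [] := cd i.
have key := chain_rule (@chart_cod_open _ _ _ c) Wt (fC c cA) dw.
apply: (@near_eq_is_derive _ _ _ ((f \o chart_inv c) \o (c \o u))).
  have : \forall r \near t, chart_dom c (u r).
    by apply: uc; apply: open_nbhs_nbhs; split=> //; exact: chart_dom_open.
  by apply: filterS => r Ur /=; rewrite chart_funK.
apply: is_derive_eq key _; apply: eq_bigr => i _; congr (_ * _).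
by have [_ ->] := cd i.
Qed.

End Curves.

(** * The pointwise alternatives and the propagation of zeros along an orbit *)

Section FieldEquation.
Variables (R : realType) (D : nat) (hD : (2 <= D)%N) (M : manifold R D).
Variables (g : components M 2) (hg : lorentzian g).
Variables (E : components M 2) (hE : metric_polynomial g E).
Variables (phi : M -> R) (hphi : smooth phi).
Variables (p : 'rV[R]_2 -> R) (hp : nonsingular_p g phi p).
Hypothesis hfield : field_equation g phi p E.
Variables (xi : vcomponents M) (hxi : killing g xi).
Local Notation X := (kinetic g phi).
Local Notation pphi := (p_phi g phi p).
Local Notation pX := (p_X g phi p).
Local Notation L := (lie xi phi).
Local Notation LL := (lie xi L).
Local Notation Y := (fun x => pphi x * L x ^+ 2 + 2 * X x * pX x * LL x).

Let lie_along f x : lie xi f x = along (chart_at x) (xi (chart_at x)) f x.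
Proof. by apply: eq_bigr => d _; rewrite pderE. Qed.

Let cA (x : M) : atlas (chart_at x) := chart_at_atlas x.
Let cU (x : M) : chart_dom (chart_at x) x := chart_at_dom x.

Lemma lie_p_eq0 x : pphi x * L x + pX x * lie xi X x = 0.
Proof.
rewrite (lie_along X); exact: (field_lie_p hg hphi hxi (cA x) hp hE hfield hD (cU x)).
Qed.

Lemma lie_XpX_eq0 x : X x * lie xi pX x + pX x * lie xi X x = 0.
Proof.
rewrite !(lie_along X, lie_along pX).
exact: (field_lie_pX hg hphi hxi (cA x) hp hE hfield hD (cU x)).
Qed.

Lemma xi_xi_eq0 x : lie xi pX x * L x ^+ 2 + 2 * pX x * L x * LL x = 0.
Proof.
rewrite (lie_along pX) (lie_along L).
exact: (field_xi hg hphi hxi (cA x) hp hE hfield hD (cU x)).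
Qed.

(** X times [xi_xi_eq0], plus f^2 times the difference of the other two identities, eliminates the
    derivatives of [pX] and X. *)
Lemma Y_lie_eq0 x : Y x * L x = 0.
Proof.
have h1 := lie_p_eq0 x; have h2 := lie_XpX_eq0 x; have h3 := xi_xi_eq0 x.
have -> : Y x * L x =
  X x * (lie xi pX x * L x ^+ 2 + 2 * pX x * L x * LL x)
  + L x ^+ 2 * (pphi x * L x + pX x * lie xi X x)
  - L x ^+ 2 * (X x * lie xi pX x + pX x * lie xi X x) by ring.
by rewrite h1 h2 h3 !mulr0 addr0 subr0.
Qed.

(** The product of [pX] and [lie xi X] vanishes in both cases, trivially for [pX x = 0] and by
    [lie_XpX_eq0] for [X x = 0], so [lie_p_eq0] reduces to its first term. *)
Lemma lie_eq0 x : pphi x <> 0 -> X x * pX x = 0 -> L x = 0.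
Proof.
move=> /eqP pphi0 /eqP XpX; have h1 := lie_p_eq0 x; have h2 := lie_XpX_eq0 x.
have pXL : pX x * lie xi X x = 0.
  move: XpX; rewrite mulf_eq0 => /orP[/eqP X0|/eqP ->]; last by rewrite mul0r.
  by move: h2; rewrite X0 mul0r add0r.
move: h1; rewrite pXL addr0 => /eqP.
by rewrite mulf_eq0 (negbTE pphi0) => /eqP.
Qed.

(** If [pX x = 0], not being exceptional forces [lie xi pX x] to be nonzero, and [xi_xi_eq0] gives f
    = 0. Otherwise X and its derivative along [xi] vanish, admissibility applied to [xi] removes
    [lie xi pX], and the other term of [xi_xi_eq0] remains. *)
Lemma lie_lie_eq0 x : pphi x = 0 -> X x * pX x = 0 -> admissible g phi p ->
  ~ exceptional g phi p xi x -> LL x * L x = 0.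
Proof.
move=> pphi0 XpX adm nexc; have h2 := lie_XpX_eq0 x; have h3 := xi_xi_eq0 x.
have [pX0|pX0] := eqVneq (pX x) 0.
  have a0 : lie xi pX x != 0 by apply/eqP => a0; apply: nexc.
  move: h3; rewrite pX0 mulr0 !mul0r addr0 => /eqP.
  by rewrite mulf_eq0 (negbTE a0) expf_eq0/= => /eqP ->; rewrite mulr0.
have X0 : X x = 0 by move/eqP: XpX; rewrite mulf_eq0 (negbTE pX0) orbF => /eqP.
have LX0 : lie xi X x = 0.
  by move: h2; rewrite X0 mul0r add0r => /eqP; rewrite mulf_eq0 (negbTE pX0) => /eqP.
have a0 : lie xi pX x = 0 by apply: adm => //; case: hxi.
have /eqP : 2 * pX x * (LL x * L x) = 0 by rewrite -[RHS]h3 a0; ring.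
by rewrite mulf_eq0 [2 * _ == 0]mulf_eq0 pnatr_eq0/= (negbTE pX0)/= => /eqP.
Qed.

Lemma lie_lie_eq0_of_XpX x : pphi x = 0 -> X x * pX x <> 0 -> LL x * L x = 0.
Proof.
move=> pphi0 /eqP XpX0.
have /eqP : 2 * (X x * pX x) * (LL x * L x) = 0.
  by rewrite -[RHS](Y_lie_eq0 x) pphi0; ring.
by rewrite mulf_eq0 [2 * _ == 0]mulf_eq0 pnatr_eq0/= (negbTE XpX0)/= => /eqP.
Qed.

Lemma kinetic_C1 : class_C 1 X.
Proof. by move=> c cA'; exact: (kinetic_sm hg hphi hxi cA'). Qed.

Lemma lie_phi_C1 : class_C 1 L.
Proof. by move=> c cA'; apply: (lie_phi_sm hphi hxi cA'). Qed.

Section Orbit.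
Variables (J : set R) (u : R -> M) (uJ : integral_curve xi J u).

Let oJ : open J. Proof. by case: uJ. Qed.
Let iJ : is_interval J. Proof. by case: uJ. Qed.
Let L_derive t : J t -> is_derive t (1 : R) (L \o u) (LL (u t)).
Proof. exact: integral_curve_chain uJ _ _ lie_phi_C1. Qed.

Lemma phiX_derivable (q : 'rV[R]_2 -> R) (W : set 'rV[R]_2) t :
  open W -> Ck 1 W q -> (forall x, W (phiX g phi x)) -> J t ->
  derivable (q \o phiX g phi \o u) t (1 : R).
Proof.
move=> oW qC Wx Jt.
have dw i : derivable (fun r => (phiX g phi \o u) r 0 i) t (1 : R).
  have [->|->] : i = 0 \/ i = 1.
    by case: i => -[|[|//]] ii; [left|right]; apply: val_inj.
  - have -> : (fun r => (phiX g phi \o u) r 0 0) = phi \o u.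
      by apply/funext => r; rewrite mxE.
    by have [] := integral_curve_chain uJ (hphi 1%N) Jt.
  have -> : (fun r => (phiX g phi \o u) r 0 1) = X \o u.
    by apply/funext => r; rewrite mxE.
  by have [] := integral_curve_chain uJ kinetic_C1 Jt.
by have [] := chain_rule oW (Wx (u t)) qC dw.
Qed.

Lemma lie_lie_of_zero t : J t -> (forall s, J s -> L (u s) = 0) -> LL (u t) = 0.
Proof.
move=> Jt L0; have [_ <-] := L_derive Jt.
rewrite (@near_eq_derive _ _ _ _ (cst 0)) ?derive_cst//.
by have := open_nbhs_nbhs (conj oJ Jt); apply: filterS => s; exact: L0.
Qed.

Let mulKf_div (a k q : R) : k != 0 -> k * (a / k * q) = a * q.
Proof. by move=> k0; field. Qed.

(** Both alternatives make f^2 a solution of a linear homogeneous equation on [J], in the second one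
    with coefficient 0. *)
Lemma lie_zero_propagates t0 t :
  (forall s, J s -> X (u s) * pX (u s) <> 0) \/
  (forall s, J s -> L (u s) * LL (u s) = 0) ->
  J t0 -> J t -> L (u t0) = 0 -> L (u t) = 0.
Proof.
move=> hyp Jt0 Jt L0.
have hd s : J s -> is_derive s (1 : R) (fun r => L (u r) * L (u r))
    (2 * (L (u s) * LL (u s))).
  move=> Js; have [dL dE] := L_derive Js.
  have := is_deriveM (L_derive Js) (L_derive Js) => dLL.
  apply: is_derive_eq dLL _; rewrite /GRing.scale/=; ring.
have sq s : L (u s) * L (u s) = 0 -> L (u s) = 0.
  by move/eqP; rewrite mulf_eq0 orbb => /eqP.
apply: sq; case: hyp => [XpX|LLL]; last first.
  apply: (@linear_ode_zero R J (fun r => L (u r) * L (u r)) (cst 0) t0 t) => //.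
  - by move=> s _; exact: cst_continuous.
  - by move=> s _; rewrite -expr2 sqr_ge0.
  - by move=> s Js; apply: is_derive_eq (hd s Js) _; rewrite LLL// mulr0 mul0r.
  by rewrite L0 mul0r.
(* Y f = 0 divided by X p_X reads (f^2)' = b f^2. That [b] contains f itself is harmless: along the
   given curve it is just a continuous function. *)
pose b s := - (pphi (u s) * L (u s)) / (X (u s) * pX (u s)).
apply: (@linear_ode_zero R J (fun r => L (u r) * L (u r)) b t0 t) => //.
- move=> s Js; apply: derivable_continuous_at.
  have [W [oW pC Wx]] := hp.
  have d1 : derivable (pphi \o u) s (1 : R).
    exact: phiX_derivable oW (Ck_partial 0 pC) Wx Js.
  have d2 : derivable (pX \o u) s (1 : R).
    exact: phiX_derivable oW (Ck_partial 1 pC) Wx Js.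
  have [d3 _] := integral_curve_chain uJ kinetic_C1 Js.
  have [d4 _] := L_derive Js.
  have d5 := derivableM d3 d2.
  have XpXs : ((X \o u) * (pX \o u)) s != 0 by exact/eqP/XpX.
  have d6 : derivable (fun r => (((X \o u) * (pX \o u)) r)^-1) s (1 : R).
    exact: derivableV XpXs d5.
  exact: derivableM (derivableN (derivableM d1 d4)) d6.
- by move=> s _; rewrite -expr2 sqr_ge0.
- move=> s Js; apply: is_derive_eq (hd s Js) _.
  apply: (mulfI (introN eqP (XpX s Js))); rewrite /b.
  have := Y_lie_eq0 (u s) => YL.
  have -> : X (u s) * pX (u s) * (2 * (L (u s) * LL (u s))) =
    Y (u s) * L (u s) - pphi (u s) * L (u s) ^+ 3 by ring.
  by rewrite YL mulKf_div; [ring|exact/eqP/XpX].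
by rewrite L0 mul0r.
Qed.

End Orbit.
End FieldEquation.

Theorem theorem4 (R : realType) (D : nat) (hD : (2 <= D)%N)
  (M : manifold R D) (g : components M 2) (hg : lorentzian g)
  (E : components M 2) (hE : metric_polynomial g E)
  (phi : M -> R) (hphi : smooth phi)
  (p : 'rV[R]_2 -> R) (hp : nonsingular_p g phi p)
  (hfield : field_equation g phi p E)
  (xi : vcomponents M) (hxi : killing g xi) :
  let X := kinetic g phi in
  let pphi := p_phi g phi p in
  let pX := p_X g phi p in
  let Lphi := lie xi phi in
  let LLphi := lie xi Lphi in
  let Y := fun x => pphi x * Lphi x ^+ 2 + 2 * X x * pX x * LLphi x in
  (forall x : M,
    [/\ pphi x <> 0 -> X x * pX x = 0 -> Lphi x = 0,
        pphi x <> 0 -> X x * pX x <> 0 -> Y x * Lphi x = 0,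
        pphi x = 0 -> X x * pX x = 0 -> admissible g phi p ->
          ~ exceptional g phi p xi x -> LLphi x * Lphi x = 0
      & pphi x = 0 -> X x * pX x <> 0 -> LLphi x * Lphi x = 0])
  /\
  (forall gamma : set M,
    nonsingular_orbit xi gamma ->
    (forall x, gamma x -> ~ exceptional g phi p xi x) ->
    class_C 1 Lphi ->
    ((forall x, gamma x -> X x * pX x = 0) -> admissible g phi p ->
       forall x, gamma x -> LLphi x = 0)
    /\
    ((forall x, gamma x -> X x * pX x <> 0) ->
       (forall x, gamma x -> Y x = 0) /\
       ((forall x, gamma x -> Lphi x = 0) \/
        (forall x, gamma x -> Lphi x <> 0)))).
Proof.
move=> X pphi pX Lphi LLphi Y.
have YL x : Y x * Lphi x = 0.
  exact: (@Y_lie_eq0 R D hD M g hg E hE phi hphi p hp hfield xi hxi x).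
have partA x : pphi x <> 0 -> X x * pX x = 0 -> Lphi x = 0.
  exact: (@lie_eq0 R D hD M g hg E hE phi hphi p hp hfield xi hxi x).
have partC x : pphi x = 0 -> X x * pX x = 0 -> admissible g phi p ->
    ~ exceptional g phi p xi x -> LLphi x * Lphi x = 0.
  exact: (@lie_lie_eq0 R D hD M g hg E hE phi hphi p hp hfield xi hxi x).
split=> [x|gamma [[s ->] _] nexc _].
  split=> [|_ _||]; [exact: partA|exact: YL|exact: partC|].
  exact: (@lie_lie_eq0_of_XpX R D hD M g hg E hE phi hphi p hp hfield xi hxi x).
split=> [XpX0 adm x [J [u [uJ [t0 [t [Jt0 Jt ut0 <-]]]]]]|XpX].
  have inO r : J r -> orbit_through xi s (u r).
    by move=> Jr; exists J, u; split=> //; exists t0, r.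
  have LLL r : J r -> Lphi (u r) * LLphi (u r) = 0.
    move=> /inO Or; have [pphi0|/eqP pphi0] := eqVneq (pphi (u r)) 0.
      by rewrite mulrC partC//; [exact: XpX0|exact: nexc].
    by rewrite partA ?mul0r//; exact: XpX0.
  (* Where f is nonzero [LLL] can be divided by it; a zero of f spreads over the whole curve and
     makes its derivative vanish. *)
  have [L0|L0] := eqVneq (Lphi (u t)) 0; last first.
    by have /eqP := LLL t Jt; rewrite mulf_eq0 (negbTE L0) => /eqP.
  apply: (lie_lie_of_zero hphi hxi uJ Jt) => r Jr.
  apply: (lie_zero_propagates hD hg hE hphi hp hfield hxi uJ _ Jt Jr L0).
  by right.
(* Two points of the orbit may lie on different curves, but each shares a curve with [s], so all
   comparisons go through [s]. *)
have dich x : orbit_through xi s x -> (Lphi s = 0 -> Lphi x = 0 /\ LLphi x = 0) /\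
    (Lphi x = 0 -> Lphi s = 0).
  move=> [J [u [uJ [t0 [t [Jt0 Jt ut0 <-]]]]]].
  have hyp : (forall r, J r -> X (u r) * pX (u r) <> 0) \/
      (forall r, J r -> Lphi (u r) * LLphi (u r) = 0).
    by left=> r Jr; apply: XpX; exists J, u; split=> //; exists t0, r.
  have prop := lie_zero_propagates hD hg hE hphi hp hfield hxi uJ hyp.
  rewrite -ut0; split=> [L0|]; last exact: prop.
  split; first exact: prop L0.
  by apply: (lie_lie_of_zero hphi hxi uJ Jt) => r Jr; exact: prop L0.
(* If f vanishes on the orbit, so does [LLphi], and both terms of Y are zero; otherwise f has no
   zero and Y f = 0 can be divided by it. *)
have [L0|L0] := eqVneq (Lphi s) 0.
  split=> [x /dich[/(_ L0)[Lx LLx] _]|]; first by rewrite /Y Lx LLx expr0n !mulr0 addr0.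
  by left=> x /dich[/(_ L0)[]].
have Lx x : orbit_through xi s x -> Lphi x != 0.
  by move=> /dich[_ h]; apply: contra_neq L0.
split=> [x /Lx Lx0|]; last by right=> x /Lx /eqP.
by have /eqP := YL x; rewrite mulf_eq0 (negbTE Lx0) orbF => /eqP.
Qed.
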